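(* Consider the VCG-Learn algorithm described in the context and assume all agents are truthful. Let $R^{\mathrm{VCG}}_T=\max(nR_T,R^{\mathrm a}_T,R_{0,T})$ be the VCG regret. The following hold for any $\mathtt{price}\in\{\mathrm{AGE},\mathrm{SEL}\}$. When $\mathtt{est}=\mathrm{ETC}$, for all $T>2K$, $$\mathbb E[R^{\mathrm{VCG}}_T]\ \le\ \Big(3V_{\max}(n+3)+10\,\sigma(5n^2+n)\sqrt{\log(|\mathcal S|T)}\Big)K^{1/3}T^{2/3}+4V_{\max}(n^2+3n)\ \in\ \widetilde O(n^2K^{1/3}T^{2/3}).$$ When $\mathtt{est}=\mathrm{OPT}$, for all $T>2K$, $$\mathbb E[R^{\mathrm{VCG}}_T]\ \le\ 9\sigma(3n^2+n)\sqrt{|\mathcal S|T\log(|\mathcal S|T)}+\Big(3V_{\max}(n+3)+20\sigma n^2\sqrt{\log(|\mathcal S|T)}\Big)K^{1/3}T^{2/3}+6V_{\max}(n^2+3n)\ \in\ \widetilde O(n^2K^{1/3}T^{2/3}).$$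
   Context: Problem. There are $n$ agents and a seller. There is a finite set of outcomes $\Omega$, a finite set of allocations $\mathcal S$, and maps $\phi_i:\Omega\to\mathcal S$ ($\phi_i(\omega)$ is agent $i$'s allocation under $\omega$). Agent $i$ has a value function $v_i:\mathcal S\to[0,1]$; write $v_i(\omega)=v_i(\phi_i(\omega))$. The seller has a known value function $v_0:\Omega\to\mathbb R$. In each round $t=1,2,\dots$ the mechanism chooses an outcome $\omega_t$ and prices $p_{i,t}$; agent $i$ then realises a reward $X_{i,t}$ drawn from a $\sigma$-sub-Gaussian distribution with mean $v_i(\phi_i(\omega_t))$ depending only on $i$ and the allocation $\phi_i(\omega_t)$, independently across agents and rounds. Each agent participates either by bids (she submits once, before round 1, a bid function $b_i:\mathcal S\to[0,1]$) or by rewards (she reports $Y_{i,t}$ at the end of each round). Being truthful means $b_i=v_i$, respectively $Y_{i,t}=X_{i,t}$ for all $t$. VCG benchmark and regrets. $V(\omega)=v_0(\omega)+\sum_iv_i(\omega)$ is the welfare, $V_{-i}(\omega)=v_0(\omega)+\sum_{j\ne i}v_j(\omega)$; $\omega^\star=\mathrm{argmax}_\omega V(\omega)$ (assumed unique); $p_i^\star=\max_\omega V_{-i}(\omega)-V_{-i}(\omega^\star)$; $u_i^\star=v_i(\omega^\star)-p_i^\star$; $u_0^\star=v_0(\omega^\star)+\sum_ip_i^\star$. With $u_{i,t}=v_i(\omega_t)-p_{i,t}$ and $u_{0,t}=v_0(\omega_t)+\sum_ip_{i,t}$, define $R_T=\sum_{t=1}^T(V(\omega^\star)-V(\omega_t))$,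 $R_{i,T}=\sum_{t=1}^T(u_i^\star-u_{i,t})$, $R^{\mathrm a}_T=\sum_{i=1}^nR_{i,T}$, $R_{0,T}=\sum_{t=1}^T(u_0^\star-u_{0,t})$. $V_{\max}$ denotes an upper bound on the expected welfare $V(\omega)$, $\omega\in\Omega$ (in the $\widetilde O$ statements, $V_{\max}\in O(n)$). Algorithm (VCG-Learn). Let $K$ be the minimum number of rounds needed to assign every allocation in $\mathcal S$ to every agent at least once. The algorithm proceeds in brackets $q=1,2,\dots$. Bracket $q$ starts with an explore phase of $K$ rounds, following a fixed non-adaptive sequence of outcomes that assigns every allocation to every agent at least once; prices are $0$ and reported rewards are collected. It is followed by $\lfloor\frac56Kq^{1/2}\rfloor$ further rounds. On such a round $t$ of bracket $q$: let $D_t$ be the set of explore-phase rounds before $t$ if $\mathtt{est}=\mathrm{ETC}$, and $D_t=\{1,\dots,t-1\}$ if $\mathtt{est}=\mathrm{OPT}$ (if an agent receives the same allocation several times in one explore phase, only one of those reports, chosen arbitrarily, is used). For an agent participating by rewards let $N_{i,t}(s)$ be the number of used rounds $\ell\in D_t$ with $\phi_i(\omega_\ell)=s$, let $\bar v_{i,t}(s)$ be the average of the corresponding reports $Y_{i,\ell}$ clipped to $[0,1]$, and let $\hat v_{i,t}(s),\check v_{i,t}(s)=\bar v_{i,t}(s)\pm\sigma\sqrt{\frac{5\log(t-qK+1)+2\log|\mathcal S|}{N_{i,t}(s)}}$ (upper, lower). For an agent participating by bids, $\bar v_{i,t}=\hat v_{i,t}=\check v_{i,t}=b_i$. The outcome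 is $\omega_t\in\mathrm{argmax}_{\omega}\big(v_0(\omega)+\sum_{i=1}^n\hat v_{i,t}(\phi_i(\omega))\big)$. Set $(f_{i,t},g_{i,t})=(\check v_{i,t},\hat v_{i,t})$ if $\mathtt{price}=\mathrm{AGE}$ and $(f_{i,t},g_{i,t})=(\hat v_{i,t},\check v_{i,t})$ if $\mathtt{price}=\mathrm{SEL}$. With $F_{-i,t}(\omega)=v_0(\omega)+\sum_{j\ne i}f_{j,t}(\phi_j(\omega))$ and $G_{-i,t}(\omega)=v_0(\omega)+\sum_{j\neq i}g_{j,t}(\phi_j(\omega))$, agent $i$ is charged $p_{i,t}=\max_{\omega}F_{-i,t}(\omega)-G_{-i,t}(\omega_t)$. $\widetilde O$ hides factors polylogarithmic in $T$ and $|\mathcal S|$, constants depending on $\sigma$, and (in the OPT case) lower-order terms in $T$.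
   Formalization: The formal statement also assumes v_0(ω) ≥ −V_max for every ω: with v_0 unbounded below, exploring one very costly outcome already violates the stated bounds. The Õ claims are read as T → ∞ with n, K, |S| fixed and constants independent of them. *)

(* Defs.v *)
From mathcomp Require Import all_boot all_order all_algebra.
From mathcomp Require Import all_classical all_reals all_analysis.

Set Implicit Arguments.
Unset Strict Implicit.
Unset Printing Implicit Defensive.

Import Order.TTheory GRing.Theory Num.Theory.
Import numFieldNormedType.Exports.

Local Open Scope classical_set_scope.
Local Open Scope ring_scope.

Inductive est_mode := ETC | OPT.
Inductive price_mode := AGE | SEL.

Section Mechanism.
Context (R : realType) (n : nat) (Omega S : finType).
Variables (phi : 'I_n -> Omega -> S) (v0 : Omega -> R).
Implicit Types (f : 'I_n -> S -> R) (i : 'I_n) (s : S) (o : Omega).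

Definition welfare f o : R := v0 o + \sum_(i < n) f i (phi i o).

Definition welfare_without f i o : R :=
  v0 o + \sum_(j < n | j != i) f j (phi j o).

(* The maximum of g over all of Omega.  The witness o0 only certifies that
   Omega is nonempty; the value does not depend on it. *)
Definition max_outcome (o0 : Omega) (g : Omega -> R) : R :=
  \big[Num.max/g o0]_(o : Omega) g o.

Definition is_unique_argmax (g : Omega -> R) (ostar : Omega) : Prop :=
  forall o, o != ostar -> g o < g ostar.

Definition is_argmax (g : Omega -> R) (o : Omega) : Prop :=
  forall o', g o' <= g o.

Definition covers (k : nat) (e : 'I_k -> Omega) : Prop :=
  forall i s, exists r : 'I_k, phi i (e r) = s.

Definition is_min_cover_length (K : nat) : Prop :=
  (exists e : 'I_K -> Omega, covers e) /\
  (forall (k : nat) (e : 'I_k -> Omega), covers e -> (K <= k)%N).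

Section Benchmark.
Variables (v : 'I_n -> S -> R) (ostar : Omega).

Definition vcg_price i : R :=
  max_outcome ostar (welfare_without v i) - welfare_without v i ostar.

Definition vcg_utility i : R := v i (phi i ostar) - vcg_price i.

Definition vcg_seller_utility : R := v0 ostar + \sum_(i < n) vcg_price i.

(* w t and p i t are the outcome and the prices of round t = 1, 2, ... ;
   the values at t = 0 are never used. *)
Variables (w : nat -> Omega) (p : 'I_n -> nat -> R).

Definition welfare_regret (T : nat) : R :=
  \sum_(1 <= t < T.+1) (welfare v ostar - welfare v (w t)).

Definition agent_regret i (T : nat) : R :=
  \sum_(1 <= t < T.+1) (vcg_utility i - (v i (phi i (w t)) - p i t)).

Definition agents_regret (T : nat) : R := \sum_(i < n) agent_regret i T.

Definition seller_regret (T : nat) : R :=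
  \sum_(1 <= t < T.+1)
     (vcg_seller_utility - (v0 (w t) + \sum_(i < n) p i t)).

Definition vcg_regret (T : nat) : R :=
  Num.max (n%:R * welfare_regret T)
    (Num.max (agents_regret T) (seller_regret T)).

End Benchmark.

Section Algorithm.
Variables (sigma : R) (K : nat).

Definition exploit_length (q : nat) : nat :=
  Num.truncn (5 / 6 * K%:R * Num.sqrt (q%:R : R)).

(* Number of rounds that precede bracket q, for q >= 1: bracket q occupies
   the rounds t with bracket_start q < t <= bracket_start q.+1. *)
Definition bracket_start (q : nat) : nat :=
  (\sum_(1 <= j < q) (K + exploit_length j))%N.

(* When K > 0, the bracket of round l is at most l. *)
Definition explore_round (l : nat) : bool :=
  has (fun q => bracket_start q < l <= bracket_start q + K)%N (iota 1 l).

(* sel q i s is the position, within the explore phase of bracket q, of the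
   only report of that phase which is used to estimate agent i's value for s *)
Variables (e : 'I_K -> Omega) (sel : nat -> 'I_n -> S -> 'I_K).

Definition valid_selection : Prop :=
  forall q i s, phi i (e (sel q i s)) = s.

Definition selected_round i s (l : nat) : bool :=
  has (fun q => l == bracket_start q + (sel q i s).+1)%N (iota 1 l).

Variables (est : est_mode) (price : price_mode).

(* by_rewards i: agent i participates by rewards (otherwise by bids);
   b: bids; Y i t: the reward reported by agent i at the end of round t *)
Variables (by_rewards : 'I_n -> bool) (b : 'I_n -> S -> R).
Variables (Y : 'I_n -> nat -> R) (w : nat -> Omega) (p : 'I_n -> nat -> R).

Definition used_round i s (l : nat) : bool :=
  (phi i (w l) == s) &&
  (selected_round i s l ||
   match est with ETC => false | OPT => ~~ explore_round l end).

Definition num_used i (t : nat) s : nat :=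
  (\sum_(1 <= l < t | used_round i s l) 1)%N.

Definition clip01 (x : R) : R := Num.min 1 (Num.max 0 x).

(* It is the average that is clipped, not the individual reports: clipping
   these would change their mean. *)
Definition clipped_mean i (t : nat) s : R :=
  clip01 ((\sum_(1 <= l < t | used_round i s l) Y i l) / (num_used i t s)%:R).

Definition conf_width (q : nat) i (t : nat) s : R :=
  sigma * Num.sqrt ((5 * ln ((t - q * K + 1)%:R : R) + 2 * ln (#|S|%:R : R))
                    / (num_used i t s)%:R).

Definition upper_value (q t : nat) i s : R :=
  if by_rewards i then clipped_mean i t s + conf_width q i t s else b i s.

Definition lower_value (q t : nat) i s : R :=
  if by_rewards i then clipped_mean i t s - conf_width q i t s else b i s.

Definition price_f (q t : nat) : 'I_n -> S -> R :=
  match price with AGE => lower_value q t | SEL => upper_value q t end.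

Definition price_g (q t : nat) : 'I_n -> S -> R :=
  match price with AGE => upper_value q t | SEL => lower_value q t end.

(* w and p are the outcomes and prices chosen by the mechanism when the
   reports are b and Y; ties in the argmax may be broken in any way. *)
Definition vcg_learn : Prop :=
  (forall (q : nat) (r : 'I_K), (0 < q)%N ->
     let t := (bracket_start q + r.+1)%N in
     w t = e r /\ forall i, p i t = 0) /\
  (forall q t : nat, (0 < q)%N ->
     (bracket_start q + K < t <= bracket_start q.+1)%N ->
     is_argmax (welfare (upper_value q t)) (w t) /\
     forall i, p i t = max_outcome (w t) (welfare_without (price_f q t) i)
                       - welfare_without (price_g q t) i (w t)).

End Algorithm.
End Mechanism.

Section Rewards.
Context (R : realType).

Definition has_mean (nu : probability (measurableTypeR R) R) (m : R) : Prop :=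
  (\int[nu]_x x%:E = m%:E)%E.

Definition sub_gaussian (sigma : R) (nu : probability (measurableTypeR R) R)
    (m : R) : Prop :=
  forall lambda : R,
    (\int[nu]_x (expR (lambda * (x - m)))%:E
       <= (expR (lambda ^+ 2 * sigma ^+ 2 / 2))%:E)%E.

Context (n : nat) (Omega S : finType) (phi : 'I_n -> Omega -> S).
Context (d : measure_display) (Xi : measurableType d) (P : probability Xi R).
Variables (nu : 'I_n -> S -> probability (measurableTypeR R) R).
Variables (w : nat -> Xi -> Omega) (X : 'I_n -> nat -> {RV P >-> R}).

(* events observable just before the rewards of round t are drawn: generated
   by the outcomes of rounds 1..t and the rewards of rounds 1..t-1 *)
Definition history (t : nat) : set (set Xi) :=
  <<s [set A | (exists l o, (0 < l <= t)%N /\ A = w l @^-1` [set o]) \/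
               (exists i l (B : set R),
                  [/\ (0 < l < t)%N, measurable B & A = X i l @^-1` B])] >>.

(* Given the history and w t = o, the rewards X i t are independent across i
   and X i t has law nu i (phi i o).  Since w t takes finitely many values,
   this is expressed without conditional expectations. *)
Definition bandit_rewards : Prop :=
  (forall t o, (0 < t)%N -> measurable (w t @^-1` [set o])) /\
  (forall t o (H : set Xi) (B : 'I_n -> set R),
     (0 < t)%N -> history t H -> (forall i, measurable (B i)) ->
     P (H `&` w t @^-1` [set o] `&` [set x | forall i, B i (X i t x)])
     = (P (H `&` w t @^-1` [set o]) * \prod_(i < n) nu i (phi i o) (B i))%E).

Definition truthful (v : 'I_n -> S -> R) (by_rewards : 'I_n -> bool)
    (b : 'I_n -> S -> R) (Y : 'I_n -> nat -> Xi -> R) : Prop :=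
  forall i, if by_rewards i
            then forall t x, (0 < t)%N -> Y i t x = X i t x
            else b i = v i.

End Rewards.

Definition regret_rate (R : realType) (K T : nat) : R :=
  K%:R `^ (1 / 3) * T%:R `^ (2 / 3).

Definition regret_bound (R : realType) (est : est_mode) (sigma : R)
    (n K card_S : nat) (Vmax : R) (T : nat) : R :=
  let N : R := n%:R in
  let L : R := ln (card_S * T)%:R in
  match est with
  | ETC =>
      (3 * Vmax * (N + 3) + 10 * sigma * (5 * N ^+ 2 + N) * Num.sqrt L)
        * regret_rate R K T
      + 4 * Vmax * (N ^+ 2 + 3 * N)
  | OPT =>
      9 * sigma * (3 * N ^+ 2 + N) * Num.sqrt (card_S%:R * T%:R * L)
      + (3 * Vmax * (N + 3) + 20 * sigma * N ^+ 2 * Num.sqrt L)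
        * regret_rate R K T
      + 6 * Vmax * (N ^+ 2 + 3 * N)
  end.

(* Main.v *)
(* The regrets are bounded round by round.  An explore round costs at most
   2 n Vmax.  In an exploit round, write every estimate as v up to a confidence
   width c and an excess deviation D = max(0, |clipped mean - v| - c): all three
   regrets are then at most
     4n sum_i c_i(w_t) + 2n^2 max c + 4n sum D,
   with no case distinction between "good" and "bad" events, nor on the prices.
   - The number of explore rounds up to T is at most 3/2 K^(1/3) T^(2/3) + 1.
   - Widths are O(1/sqrt q) in bracket q, and the sum over exploit rounds of
     1/sqrt q is at most 5/6 of the number of explore rounds.  For OPT the
     widths at the chosen outcomes are summed by pigeonhole instead.
   - For fixed lam, exp(lam Z - lam^2 sigma^2 N / 2), with Z the centred sum of
     the N used rewards, is a supermartingale.  Using on the event N = m the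
     parameter lam tuned to m, and summing over m <= T, gives
     E D <= 4 sigma sqrt T / (tau^2 |S|) in the (tau-1)-th exploit round, which
     is summable in tau. *)
From HB Require Import structures.
Require Import Defs.
From mathcomp Require Import all_boot all_order all_algebra.
From mathcomp Require Import all_classical all_reals all_analysis.
From mathcomp Require Import measurable_realfun.
From mathcomp Require Import ring lra.
From mathcomp Require Import zify.

Set Implicit Arguments.
Unset Strict Implicit.
Unset Printing Implicit Defensive.

Import Order.TTheory GRing.Theory Num.Theory.
Import numFieldNormedType.Exports.

Local Open Scope classical_set_scope.
Local Open Scope ring_scope.

(** * Brackets and the number of explore rounds *)

(** Prices are harder to learn than welfare. For welfare, an upper estimate falls short of the truth
    by at most the excess, so only the widths at the chosen outcome matter. A price contains a
    maximum over all outcomes; it needs a width valid everywhere, which only forced exploration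
    supplies. Hence [K^(1/3) T^(2/3)] persists in the bound for OPT, where pigeonhole removes the
    width cost at the chosen outcomes but not the term [2n^2 max c]. For OPT the number of used
    rewards is random and depends on past rewards, so a tail bound for a fixed sample size does not
    apply. The supermartingale copes because whether a round counts is decided before its reward is
    drawn. The price is one factor [sqrt T], harmless since [sqrt T <= K^(1/3) T^(2/3)]. The mean of
    the excess is bounded rather than the probability of a bad event: the regret of a round grows at
    most linearly in the excess, so no worst-case bound for a bad exploit round has to be found. *)

Section brackets.
Context (R : realType) (K : nat).
Hypothesis K_gt0 : (0 < K)%N.
Local Notation start := (bracket_start R K).
Local Notation len := (exploit_length R K).

Lemma bracket_start1 : start 1 = 0%N.
Proof. by rewrite /bracket_start big_geq. Qed.

Lemma bracket_startS q : (0 < q)%N -> start q.+1 = (start q + K + len q)%N.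
Proof. by move=> q0; rewrite /bracket_start big_nat_recr//= addnA. Qed.

Lemma exploit_length_le q : (len q)%:R <= 5 / 6 * K%:R * Num.sqrt (q%:R : R).
Proof. by rewrite truncn_le// !mulr_ge0// sqrtr_ge0. Qed.

Lemma exploit_length_gt q : 5 / 6 * K%:R * Num.sqrt (q%:R : R) < (len q)%:R + 1.
Proof. by rewrite natr1 /exploit_length truncnS_gt. Qed.

(** Counts the explore rounds alone. It keeps the natural subtraction [t - q * K] from truncating in
    the exploit rounds of bracket [q]. *)
Lemma bracket_start_ge q : (q * K <= start q.+1)%N.
Proof.
elim: q => [|q IH]; first by rewrite mul0n.
by rewrite bracket_startS// mulSnr -addnA leq_add// leq_addr.
Qed.

Lemma exists_bracket t : (0 < t)%N ->
  exists q, (0 < q)%N /\ (start q < t <= start q.+1)%N.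
Proof.
move=> t0; have ex : exists q, (t <= start q.+1)%N.
  by exists t; rewrite (leq_trans _ (bracket_start_ge t))// leq_pmulr.
case: (ex_minnP ex) => q tq qmin; exists q; rewrite tq andbT.
case: q tq qmin => [|q] tq qmin; first by rewrite bracket_start1 leqNgt t0 in tq.
by split=> //; rewrite ltnNge; apply/negP => /qmin; rewrite ltnn.
Qed.

Section round_sum.
Variables (F : nat -> R) (A B C : R).
Hypotheses (A0 : 0 <= A) (B0 : 0 <= B) (C0 : 0 <= C).
Hypothesis explore_le : forall q t, (0 < q)%N -> (start q < t <= start q + K)%N ->
  F t <= A.
Hypothesis exploit_le : forall q t, (0 < q)%N ->
  (start q + K < t <= start q.+1)%N ->
  F t <= B / Num.sqrt q%:R + C / (t - q * K + 1)%:R ^+ 2.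

(** Number of exploit rounds before bracket [q]. In exploit round [j + 1] of that bracket,
    [t - q * K + 1] equals [exploited q + j + 2]. Across brackets it thus takes the values 2, 3, ...
    once each, and a telescoping sum bounds the inverse squares by 1 in total. *)
Let exploited q := (start q - q.-1 * K)%N.

Let inv_sqr_le (k : nat) : C / k.+2%:R ^+ 2 <= C / k.+1%:R - C / k.+2%:R.
Proof.
rewrite -mulrBr ler_wpM2l//.
have -> : k.+1%:R^-1 - k.+2%:R^-1 = (k.+1%:R * k.+2%:R)^-1 :> R.
  rewrite -(natr1 k.+1); move: (k.+1%:R : R) (ltr0Sn R k) => a a0.
  by field; rewrite !lt0r_neq0//; lra.
rewrite lef_pV2 ?posrE ?mulr_gt0 ?exprn_gt0 ?ltr0n//.
by rewrite expr2 ler_wpM2r// ler_nat.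
Qed.

Let sum_explore_phase q k : (0 < q)%N -> (k <= K)%N ->
  \sum_(1 <= t < (start q + k).+1) F t <=
  \sum_(1 <= t < (start q).+1) F t + A * k%:R.
Proof.
move=> q0; elim: k => [|k IH] kK; first by rewrite addn0 mulr0 addr0.
rewrite addnS big_nat_recr//= -natr1 mulrDr mulr1 addrA lerD ?IH ?(ltnW kK)//.
by apply: (explore_le q0); lia.
Qed.

Let sum_exploit_phase q j : (0 < q)%N -> (j <= len q)%N ->
  \sum_(1 <= t < (start q + K + j).+1) F t <=
  \sum_(1 <= t < (start q + K).+1) F t + B / Num.sqrt q%:R * j%:R
  + (C / (exploited q).+1%:R - C / (exploited q + j).+1%:R).
Proof.
move=> q0; elim: j => [|j IH] jl.
  by rewrite addn0 mulr0 addr0 addn0 subrr addr0.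
rewrite addnS big_nat_recr//=.
have := IH (ltnW jl).
have := @exploit_le q (start q + K + j).+1 q0.
rewrite bracket_startS// => /(_ ltac:(lia)).
have -> : ((start q + K + j).+1 - q * K + 1 = (exploited q + j).+2)%N.
  have := bracket_start_ge q.-1; rewrite prednK// /exploited => h.
  by case: (q) q0 h => // q' _ /= h; rewrite mulSn; lia.
have := inv_sqr_le (exploited q + j).
rewrite addnS -(natr1 j) mulrDr mulr1.
move: (C / (exploited q + j).+2%:R ^+ 2) (C / (exploited q + j).+2%:R)
  (C / (exploited q + j).+1%:R) (C / (exploited q).+1%:R) (F _) (B / _) => a b c e f u.
by lra.
Qed.

Let sum_brackets q : (0 < q)%N ->
  \sum_(1 <= t < (start q).+1) F t <=
  (A + 5 / 6 * B) * (q.-1 * K)%:R + (C - C / (exploited q).+1%:R).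
Proof.
elim: q => // -[_ _|q IH _].
  by rewrite /exploited bracket_start1 big_geq//= mul0n mulr0 divr1 subrr addr0.
have := IH isT.
have := sum_explore_phase (ltn0Sn q) (leqnn K).
have := sum_exploit_phase (ltn0Sn q) (leqnn (len q.+1)).
rewrite -bracket_startS//.
have -> : (exploited q.+1 + len q.+1 = exploited q.+2)%N.
  rewrite /exploited [in RHS]bracket_startS// -!pred_Sn mulSn.
  by have := bracket_start_ge q; lia.
(* The exploit length is made for this: a whole exploit phase costs at most [5 / 6 * B] per explore
   round of its bracket, whatever the bracket. *)
have : B / Num.sqrt q.+1%:R * (len q.+1)%:R <= 5 / 6 * B * K%:R.
  have s0 : 0 < Num.sqrt (q.+1%:R : R) by rewrite sqrtr_gt0 ltr0n.
  rewrite mulrAC ler_pdivrMr//.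
  have := ler_wpM2l B0 (exploit_length_le q.+1); lra.
rewrite /= !natrM -(natr1 q).
move: (C / (exploited q.+2).+1%:R) (C / (exploited q.+1).+1%:R) (B / _) => a b u.
move: (\sum_(1 <= t < (start q.+1).+1) F t) (\sum_(1 <= t < (start q.+2).+1) F t)
  (\sum_(1 <= t < (start q.+1 + K).+1) F t) => s1 s2 s3.
lra.
Qed.

(** Everything is charged to the explore rounds up to [T]: [K] in each of [m] finished brackets and
    [r] in the current one. An unfinished exploit phase costs no more than a full one, which the
    [r = K] explore rounds before it pay for. *)
Lemma sum_rounds T : (0 < T)%N -> exists m r,
  [/\ (0 < r <= K)%N, (start m.+1 + r <= T)%N &
   \sum_(1 <= t < T.+1) F t <= (A + 5 / 6 * B) * (m * K + r)%:R + C].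
Proof.
move=> /exists_bracket[q [q0 /andP[]]]; case: q q0 => // m _ mT Tm.
have pos k : 0 <= C / k.+1%:R by rewrite divr_ge0.
have [k Tk] : exists k, T = (start m.+1 + k)%N by exists (T - start m.+1)%N; lia.
exists m, (minn k K); split; [lia|lia|].
have h0 := sum_brackets (ltn0Sn m); rewrite /= in h0.
have [kK|Kk] := leqP k K.
  have h1 := sum_explore_phase (ltn0Sn m) kK.
  rewrite Tk natrD mulrDr.
  have : 0 <= 5 / 6 * B * k%:R by rewrite !mulr_ge0.
  move: h0 h1 (pos (exploited m.+1)).
  move: (C / _) (\sum_(1 <= t < (start m.+1).+1) F t)
    (\sum_(1 <= t < (start m.+1 + k).+1) F t) => a s1 s2.
  lra.
have h1 := sum_explore_phase (ltn0Sn m) (leqnn K).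
have [j kj] : exists j, k = (K + j)%N by exists (k - K)%N; lia.
have jl : (j <= len m.+1)%N by move: Tm; rewrite bracket_startS//; lia.
have h2 := sum_exploit_phase (ltn0Sn m) jl.
rewrite Tk kj addnA natrD mulrDr.
have : B / Num.sqrt m.+1%:R * j%:R <= 5 / 6 * B * K%:R.
  have s0 : 0 < Num.sqrt (m.+1%:R : R) by rewrite sqrtr_gt0 ltr0n.
  rewrite mulrAC ler_pdivrMr//.
  have jle : j%:R <= 5 / 6 * K%:R * Num.sqrt (m.+1%:R : R).
    by apply: le_trans (exploit_length_le _); rewrite ler_nat.
  have := ler_wpM2l B0 jle; lra.
move: h0 h1 h2 (pos (exploited m.+1 + j)%N).
move: (C / (exploited m.+1 + j).+1%:R) (C / (exploited m.+1).+1%:R) (B / _)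
  (\sum_(1 <= t < (start m.+1).+1) F t)
  (\sum_(1 <= t < (start m.+1 + K).+1) F t)
  (\sum_(1 <= t < (start m.+1 + K + j).+1) F t) => a b u s1 s2 s3.
lra.
Qed.

End round_sum.

(** The left side is the integral of the square root over [[0, m]]. With [a^2 = m] and [b^2 = m + 1]
    the induction step reduces to [2 a^2 (b - a) <= b], which is clear after multiplication by
    [b + a], as [b^2 - a^2 = 1]. *)
Lemma sum_sqrt_ge m :
  2 / 3 * (m%:R * Num.sqrt m%:R) <= \sum_(1 <= j < m.+1) Num.sqrt (j%:R : R).
Proof.
elim: m => [|m IH]; first by rewrite mul0r mulr0 big_geq.
rewrite big_nat_recr//=; apply: le_trans (lerD IH (lexx _)).
have := sqr_sqrtr (ler0n R m); have := sqr_sqrtr (ler0n R m.+1).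
have := sqrtr_ge0 (m%:R : R); have := sqrtr_ge0 (m.+1%:R : R).
have : Num.sqrt (m%:R : R) <= Num.sqrt m.+1%:R by rewrite ler_sqrt// ler_nat.
rewrite -(natr1 m).
move: (Num.sqrt _) (Num.sqrt _) => b a ab b0 a0 b2 a2.
rewrite -a2 in b2 *.
have b_gt0 : 0 < b + a by nra.
have : 2 * a ^+ 2 * (b - a) <= b.
  rewrite -(ler_pM2r b_gt0).
  have -> : 2 * a ^+ 2 * (b - a) * (b + a) = 2 * a ^+ 2 * (b ^+ 2 - a ^+ 2) by ring.
  by rewrite b2; nra.
by lra.
Qed.

(** [5 / 9] is [5 / 6] times [2 / 3]. Rounding an exploit length down loses at most 1 per bracket,
    which turns [K] into [K - 1]. *)
Lemma bracket_start_ge_real m :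
  5 / 9 * K%:R * (m%:R * Num.sqrt m%:R) + m%:R * (K%:R - 1) <=
  (start m.+1)%:R :> R.
Proof.
have : \sum_(1 <= j < m.+1) (K%:R + (5 / 6 * K%:R * Num.sqrt (j%:R : R) - 1)) <=
    (start m.+1)%:R.
  rewrite /bracket_start natr_sum; apply: ler_sum => j _.
  by rewrite natrD lerD2l; have := exploit_length_gt j; lra.
apply: le_trans.
under eq_bigr do rewrite addrCA.
rewrite big_split /= -mulr_sumr sumr_const_nat subn1 -mulr_natl.
have K0 : 0 <= 5 / 6 * K%:R :> R by rewrite mulr_ge0.
by have := ler_wpM2l K0 (sum_sqrt_ge m); lra.
Qed.

Lemma regret_rate_ge0 T : 0 <= regret_rate R K T.
Proof. by rewrite mulr_ge0// powR_ge0. Qed.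

(** Cubing removes the fractional exponents and makes comparisons with the rate polynomial. *)
Lemma regret_rate_cube T : regret_rate R K T ^+ 3 = K%:R * T%:R ^+ 2.
Proof.
rewrite /regret_rate exprMn -!(powR_mulrn 3) ?powR_ge0// -!powRrM.
rewrite (_ : 1 / 3 * 3%:R = 1 :> R); last by lra.
rewrite (_ : 2 / 3 * 3%:R = 2%:R :> R); last by lra.
by rewrite powRr1// powR_mulrn.
Qed.

(** To leading order [T >= 5/9 K m^(3/2)], so [m K] is at most [(9/5)^(2/3)], about 1.48, times the
    rate; [3 / 2] leaves slack for the lower-order terms. *)
Lemma explore_count_le m r T : (0 < r <= K)%N -> (start m.+1 + r <= T)%N ->
  (m * K + r)%:R <= 3 / 2 * regret_rate R K T + 1.
Proof.
move=> /andP[r0 rK] mT.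
have rate0 := regret_rate_ge0 T.
have T_ge : 5 / 9 * K%:R * (m%:R * Num.sqrt m%:R) + m%:R * (K%:R - 1) + r%:R <=
    T%:R :> R.
  apply: (@le_trans _ _ (start m.+1 + r)%:R); last by rewrite ler_nat.
  by rewrite natrD lerD2r bracket_start_ge_real.
(* T >= 5/9 K m^(3/2) + m (K - 1) + r.  For K >= 2 the middle term absorbs the
   excess of (m K + r)^3 over (m K)^3; for K = 1 it vanishes, which costs 1. *)
suff [c [c1 hc]] : exists c : R, c <= 1 /\
    8 * ((m * K + r)%:R - c) ^+ 3 <= 27 * (K%:R * T%:R ^+ 2).
  suff : (m * K + r)%:R - c <= 3 / 2 * regret_rate R K T by lra.
  rewrite leNgt; apply/negP => lt.
  have : (3 / 2 * regret_rate R K T) ^+ 3 < ((m * K + r)%:R - c) ^+ 3.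
    by rewrite ltrXn2r ?mulr_ge0.
  rewrite exprMn regret_rate_cube; lra.
have m2 := sqr_sqrtr (ler0n R m); have z0 := sqrtr_ge0 (m%:R : R).
have := ler0n R m.
move: (Num.sqrt _) m2 z0 T_ge => z m2 z0 T_ge m0.
have [K1|K2] := leqP K 1.
  have [-> ->] : r = 1%N /\ K = 1%N by lia.
  exists 1; split=> //; rewrite muln1 natrD addrK mul1r.
  move: T_ge; have [-> ->] : r = 1%N /\ K = 1%N by lia.
  move=> T_ge.
  have : (5 / 9 * (m%:R * z)) ^+ 2 <= (T%:R : R) ^+ 2.
    by rewrite lerXn2r ?nnegrE ?mulr_ge0//; lra.
  rewrite !exprMn m2 -exprSr; have : 0 <= (m%:R : R) ^+ 3 by rewrite exprn_ge0.
  by lra.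
exists 0; split=> //; rewrite subr0.
have T_ge' : 5 / 9 * K%:R * (m%:R * z) + m%:R * (K%:R / 2) + r%:R <= T%:R :> R.
  apply: le_trans T_ge; rewrite lerD2r lerD2l ler_wpM2l//.
  have : 2 <= K%:R :> R by rewrite ler_nat.
  lra.
have Tsq : (5 / 9 * K%:R * (m%:R * z) + m%:R * (K%:R / 2) + r%:R) ^+ 2 <=
    T%:R ^+ 2 :> R.
  by rewrite lerXn2r ?nnegrE// !addr_ge0 ?mulr_ge0.
apply: le_trans (ler_wpM2l _ (ler_wpM2l _ Tsq)) => //.
rewrite natrD natrM.
have rK' : r%:R <= K%:R :> R by rewrite ler_nat.
have r0' : 0 <= r%:R :> R by [].
have m_cases : m = 0%N \/ 1 <= z.
  case: (posnP m) => [|mpos]; [by left|right].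
  rewrite -(@ler_pXn2r _ 2) ?nnegrE// expr1n m2 ler1n//.
(* The delicate term below is [- 9/4 k^2 M^2 r']. It is absorbed by [30 k^2 M r'] when [M <= 13], as
   [9/4 * 13 < 30], and by the slack [1/3 k^3 M^3], which is [25/3 - 8], when [M >= 7], as
   [7/3 > 9/4]. *)
have mc : (m%:R <= 13 :> R) \/ (7 <= m%:R :> R).
  by case: (leqP m 13) => h; [left|right]; rewrite (ler_nat R)// (leq_trans _ h).
have -> : 27 * (K%:R * (5 / 9 * K%:R * (m%:R * z) + m%:R * (K%:R / 2) + r%:R) ^+ 2)
  = 25 / 3 * K%:R ^+ 3 * m%:R ^+ 2 * z ^+ 2 + 27 / 4 * m%:R ^+ 2 * K%:R ^+ 3
    + 27 * K%:R * r%:R ^+ 2 + 15 * K%:R ^+ 3 * m%:R ^+ 2 * z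
    + 30 * K%:R ^+ 2 * m%:R * z * r%:R + 27 * m%:R * K%:R ^+ 2 * r%:R :> R.
  by field.
rewrite m2.
case: m_cases => [->|z1].
  rewrite !mul0r !mulr0 !mul0r !add0r expr0n /= !mulr0 !mul0r !addr0 !add0r.
  by nra.
move: (m%:R : R) (r%:R : R) (K%:R : R) m0 rK' r0' mc {m2 T_ge T_ge' Tsq} 
  => M r' k M0 rk r'0 mc.
have k0 : 0 <= k by lra.
have zk n' p q : 0 <= k ^+ n' * M ^+ p * r' ^+ q * (z - 1).
  by rewrite !mulr_ge0 ?exprn_ge0// subr_ge0.
have rkk n' p q : 0 <= k ^+ n' * M ^+ p * r' ^+ q * (k - r').
  by rewrite !mulr_ge0 ?exprn_ge0// subr_ge0.
have := zk 3%N 2%N 0%N; have := zk 2%N 1%N 1%N; have := rkk 1%N 1%N 1%N.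
have := rkk 0%N 0%N 2%N; have := rkk 2%N 2%N 0%N; have := exprn_ge0 2 r'0.
have : 0 <= 30 * (k ^+ 2 * M * r') + 1 / 3 * (k ^+ 3 * M ^+ 3)
    - 9 / 4 * (k ^+ 2 * M ^+ 2 * r').
  case: mc => mc.
    have : 0 <= k ^+ 2 * M * r' * (13 - M) by rewrite !mulr_ge0 ?exprn_ge0// subr_ge0.
    have : 0 <= k ^+ 2 * M * r' by rewrite !mulr_ge0 ?exprn_ge0.
    have : 0 <= k ^+ 3 * M ^+ 3 by rewrite !mulr_ge0 ?exprn_ge0.
    by lra.
  have : 0 <= k ^+ 3 * M ^+ 2 * (M - 7) by rewrite !mulr_ge0 ?exprn_ge0// subr_ge0.
  have : 0 <= k ^+ 2 * M * r' by rewrite !mulr_ge0 ?exprn_ge0.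
  have := rkk 2%N 2%N 0%N.
  have : 0 <= k ^+ 3 * M ^+ 2 by rewrite !mulr_ge0 ?exprn_ge0.
  by lra.
have : 0 <= k ^+ 3 * M ^+ 3 by rewrite !mulr_ge0 ?exprn_ge0.
have : 0 <= k * r' ^+ 2 by rewrite !mulr_ge0 ?exprn_ge0.
have : 0 <= k ^+ 2 * M * r' by rewrite !mulr_ge0 ?exprn_ge0.
by lra.
Qed.

End brackets.

(** * Asymptotics of the bounds *)

Lemma sqrtr_le_self (R : realType) (x : R) : 1 <= x -> Num.sqrt x <= x.
Proof.
move=> x1; have x0 : 0 <= x by lra.
have := sqr_sqrtr x0; have := sqrtr_ge0 x; nra.
Qed.

Lemma ln_ge1 (R : realType) (k : nat) : (2 < k)%N -> 1 <= ln (k%:R : R).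
Proof.
move=> k3; rewrite -ler_expR lnK ?posrE ?ltr0n; last by case: k k3.
apply: (@le_trans _ _ 3); last by rewrite ler_nat.
(* exp (-1) = exp (-1/6) ^ 6 >= (5/6) ^ 6 > 1/3 *)
have e0 := expR_gt0 (- 1 : R); 
rewrite -[leLHS]invrK -expRN -lef_pV2 ?posrE ?invr_gt0// invrK.
have -> : - 1 = 6%:R * (- (1 / 6)) :> R by lra.
rewrite expRM_natl; apply: (@le_trans _ _ ((5 / 6) ^+ 6)); first by lra.
apply: lerXn2r; rewrite ?nnegrE ?expR_ge0//.
by have := expR_ge1Dx (- (1 / 6) : R); lra.
Qed.

Lemma regret_bound_asymptotics (R : realType) (sigma : R) (est : est_mode) :
  0 < sigma ->
  forall c : R, exists (C : R) (a : nat),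
    forall (n K card_S : nat) (Vmax : R),
      (0 < n)%N -> (0 < K)%N -> (0 < card_S)%N -> `|Vmax| <= c * n%:R ->
      \forall T \near \oo,
        `|regret_bound est sigma n K card_S Vmax T|
          <= C * ln ((card_S * T)%:R : R) ^+ a * (n%:R ^+ 2 * regret_rate R K T).
Proof.
(* [36 = 3 * 4 + 6 * 4] and [60 = 10 * 6] cover the coefficients of both modes once lower powers of
   [n] are raised. One logarithm suffices because [Num.sqrt L <= L]. *)
move=> s0 c; exists (36 * `|c| + 60 * sigma), 1%N => n K card_S Vmax n0 K0 S0 Vc.
near=> T.
have T3 : (2 < T)%N by near: T; exists 3%N.
(* [card_S^3 <= T] yields [sqrt (card_S T) <= T^(2/3)]. [n^2 <= T] yields [n <= rho], which is
   needed because [Vmax n^2] may be of order [n^3]. *)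
have TS : (card_S ^ 3 <= T)%N by near: T; exists (card_S ^ 3)%N.
have Tn : (n ^ 2 <= T)%N by near: T; exists (n ^ 2)%N.
set rho := regret_rate R K T; set L := ln _.
have K1 : 1 <= K%:R :> R by rewrite ler1n.
have T1 : 1 <= T%:R :> R by rewrite ler1n; case: (T) T3.
have rho0 : 0 <= rho by rewrite mulr_ge0// powR_ge0.
have L1 : 1 <= L by apply: ln_ge1; rewrite (leq_trans T3)// leq_pmull.
have sqrtL0 := sqrtr_ge0 L; have sqrtL := sqrtr_le_self L1.
have n1 : 1 <= n%:R :> R by rewrite ler1n.
have rhoT : T%:R `^ (2 / 3) <= rho.
  rewrite ler_peMl ?powR_ge0//; apply: (@le_trans _ _ (K%:R `^ 0)).
    by rewrite powRr0.
  by rewrite ler_powR// divr_ge0.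
have rho_n : n%:R <= rho.
  apply: le_trans rhoT; apply: (@le_trans _ _ (T%:R `^ 2^-1)).
    rewrite powR12_sqrt//.
    rewrite -[leLHS]ger0_norm// -sqrtr_sqr ler_sqrt//.
    by rewrite -natrX ler_nat.
  by rewrite ler_powR//; lra.
have rho_S : Num.sqrt (card_S%:R * T%:R * L) <= L * rho.
  rewrite sqrtrM ?mulr_ge0// mulrC; apply: ler_pM => //; try exact: sqrtr_ge0.
  apply: le_trans rhoT; rewrite -powR12_sqrt ?mulr_ge0// powRM//.
  have -> : T%:R `^ (2 / 3) = T%:R `^ 6^-1 * T%:R `^ 2^-1 :> R.
    rewrite -powRD; first by congr (_ `^ _); lra.
    by apply/implyP => _; rewrite gt_eqF// (lt_le_trans ltr01).
  rewrite ler_wpM2r ?powR_ge0//.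
  have -> : card_S%:R `^ 2^-1 = (card_S%:R ^+ 3) `^ 6^-1 :> R.
    by rewrite -powR_mulrn// -powRrM; congr (_ `^ _); lra.
  by apply: ge0_ler_powR; rewrite ?nnegrE ?exprn_ge0// -natrX ler_nat.
have Vc' : `|Vmax| <= `|c| * n%:R.
  by apply: le_trans Vc _; rewrite ler_wpM2r// ler_norm.
have bound f g : 0 <= f <= 36 * n%:R * rho ->
    0 <= g <= 60 * sigma * n%:R ^+ 2 * (L * rho) ->
    `|Vmax * f + g| <= (36 * `|c| + 60 * sigma) * L ^+ 1 * (n%:R ^+ 2 * rho).
  move=> /andP[f0 f1] /andP[g0 g1]; apply: le_trans (ler_normD _ _) _.
  rewrite normrM (ger0_norm f0) (ger0_norm g0) expr1.
  have h1 : `|Vmax| * f <= (`|c| * n%:R) * (36 * n%:R * rho) by exact: ler_pM.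
  have h2 : `|c| * n%:R ^+ 2 * rho <= (`|c| * n%:R ^+ 2 * rho) * L.
    by rewrite ler_peMr// !mulr_ge0.
  by lra.
have rhoL : Num.sqrt L * rho <= L * rho by rewrite ler_wpM2r.
have nn : n%:R <= n%:R ^+ 2 :> R by rewrite expr2 ler_peMr.
have nrho : n%:R ^+ 2 <= n%:R * rho by rewrite expr2 ler_wpM2l.
have rho1 : n%:R * rho >= rho by rewrite ler_peMl.
have s0' := ltW s0.
have sn : 0 <= sigma * n%:R ^+ 2 by rewrite mulr_ge0 ?exprn_ge0// ltW.
have sn' : sigma * n%:R <= sigma * n%:R ^+ 2 by rewrite ler_wpM2l// ltW.
have sn0 : 0 <= sigma * n%:R by rewrite mulr_ge0// ltW.
rewrite /regret_bound -/L -/rho; case: est.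
- rewrite [X in `|X|](_ : _ = Vmax * (3 * (n%:R + 3) * rho + 4 * (n%:R ^+ 2 + 3 * n%:R)) +
    10 * (5 * (sigma * n%:R ^+ 2) + sigma * n%:R) * (Num.sqrt L * rho)); last by ring.
  apply: bound; apply/andP; split.
  + by rewrite !(mulr_ge0, addr_ge0, exprn_ge0).
  + by lra.
  + by rewrite !(mulr_ge0, addr_ge0, exprn_ge0).
  + rewrite [leRHS](_ : _ = (60 * (sigma * n%:R ^+ 2)) * (L * rho)); last by ring.
    by apply: ler_pM; rewrite ?(mulr_ge0, addr_ge0, exprn_ge0)//; lra.
- set Q := Num.sqrt (_ * _ * _) in rho_S *.
  rewrite [X in `|X|](_ : _ = Vmax * (3 * (n%:R + 3) * rho + 6 * (n%:R ^+ 2 + 3 * n%:R)) +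
    (9 * (3 * (sigma * n%:R ^+ 2) + sigma * n%:R) * Q +
     20 * (sigma * n%:R ^+ 2) * (Num.sqrt L * rho))); last by ring.
  have Q0 : 0 <= Q := sqrtr_ge0 _.
  apply: bound; apply/andP; split.
  + by rewrite !(mulr_ge0, addr_ge0, exprn_ge0).
  + by lra.
  + by rewrite !(mulr_ge0, addr_ge0, exprn_ge0).
  + rewrite [leRHS](_ : _ = (36 * (sigma * n%:R ^+ 2)) * (L * rho)
      + (24 * (sigma * n%:R ^+ 2)) * (L * rho)); last by ring.
    by apply: lerD; apply: ler_pM; rewrite ?(mulr_ge0, addr_ge0, exprn_ge0)//; lra.
Unshelve. all: by end_near.
Qed.

(** * Per-round regret *)

Section max_outcome.
Context (R : realType) (Omega : finType).
Implicit Types (g h : Omega -> R) (o : Omega).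

Lemma max_outcome_ge o0 g o : g o <= max_outcome o0 g.
Proof. by rewrite /max_outcome (bigD1 o)//= le_max lexx. Qed.

Lemma max_outcome_le o0 g (a : R) : (forall o, g o <= a) -> max_outcome o0 g <= a.
Proof.
move=> ga; rewrite /max_outcome; elim/big_ind: _ => // x y xa ya.
by rewrite ge_max xa ya.
Qed.

Lemma max_outcome_leD o0 o1 g h (a : R) : (forall o, g o <= h o + a) ->
  max_outcome o0 g <= max_outcome o1 h + a.
Proof.
move=> gh; apply: max_outcome_le => o; apply: le_trans (gh o) _.
by rewrite lerD2r max_outcome_ge.
Qed.

End max_outcome.

Section round_regret.
Context (R : realType) (n : nat) (Omega S : finType).
Variables (phi : 'I_n -> Omega -> S) (v0 : Omega -> R) (v : 'I_n -> S -> R).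
Variable ostar : Omega.
Hypothesis ostar_max : is_unique_argmax (welfare phi v0 v) ostar.
Implicit Types (f g : 'I_n -> S -> R) (o : Omega).

(** The regret is a maximum of three sums over rounds; a bound shared by the three in each round can
    be summed before the maximum is taken. *)
Definition round_regret_le (o : Omega) (q : 'I_n -> R) (beta : R) : Prop :=
  [/\ n%:R * (welfare phi v0 v ostar - welfare phi v0 v o) <= beta,
   \sum_(i < n) (vcg_utility phi v0 v ostar i - (v i (phi i o) - q i)) <= beta &
   vcg_seller_utility phi v0 v ostar - (v0 o + \sum_(i < n) q i) <= beta].

Lemma vcg_regret_le (w : nat -> Omega) (p : 'I_n -> nat -> R) (beta : nat -> R) T :
  (forall t, (0 < t <= T)%N -> round_regret_le (w t) (p ^~ t) (beta t)) ->
  vcg_regret phi v0 v ostar w p T <= \sum_(1 <= t < T.+1) beta t.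
Proof.
move=> h; rewrite /vcg_regret !ge_max; apply/and3P; split.
- rewrite /welfare_regret mulr_sumr.
  by apply: ler_sum_nat => t /h[].
- rewrite /agents_regret /agent_regret exchange_big /=.
  by apply: ler_sum_nat => t /h[].
- by apply: ler_sum_nat => t /h[].
Qed.

Lemma welfare_le_max o : welfare phi v0 v o <= welfare phi v0 v ostar.
Proof. by have [->//|/ostar_max/ltW] := eqVneq o ostar. Qed.

Lemma welfare_withoutE f i o :
  welfare_without phi v0 f i o = welfare phi v0 f o - f i (phi i o).
Proof. by rewrite /welfare /welfare_without [in RHS](bigD1 i)//=; ring. Qed.

Lemma welfare_leD f g o (a : 'I_n -> R) :
  (forall i, f i (phi i o) <= g i (phi i o) + a i) ->
  welfare phi v0 f o <= welfare phi v0 g o + \sum_(i < n) a i.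
Proof.
by move=> fg; rewrite -addrA -big_split lerD2l; apply: ler_sum.
Qed.

Lemma welfare_without_leD f g i o (a : 'I_n -> R) : (forall j, 0 <= a j) ->
  (forall j, f j (phi j o) <= g j (phi j o) + a j) ->
  welfare_without phi v0 f i o <= welfare_without phi v0 g i o + \sum_(j < n) a j.
Proof.
move=> a0 fg; rewrite -addrA lerD2l.
apply: (@le_trans _ _ (\sum_(j < n | j != i) (g j (phi j o) + a j))).
  exact: ler_sum.
by rewrite big_split lerD2l (bigD1 i (P := xpredT))//= lerDr.
Qed.

Lemma vcg_utilityE i : vcg_utility phi v0 v ostar i =
  welfare phi v0 v ostar - max_outcome ostar (welfare_without phi v0 v i).
Proof. by rewrite /vcg_utility /vcg_price welfare_withoutE; ring. Qed.

Lemma vcg_utility_le i : vcg_utility phi v0 v ostar i <= v i (phi i ostar).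
Proof.
rewrite /vcg_utility gerDl oppr_le0 subr_ge0; exact: max_outcome_ge.
Qed.

Lemma sum_welfare_without o :
  \sum_(i < n) welfare_without phi v0 v i o =
  n%:R * welfare phi v0 v o - (welfare phi v0 v o - v0 o).
Proof.
under eq_bigr do rewrite welfare_withoutE.
rewrite sumrB sumr_const card_ord -[_ *+ n]mulr_natl; congr (_ - _).
by rewrite /welfare addrAC subrr add0r.
Qed.

Section explore.
Variable Vmax : R.
Hypothesis n_gt0 : (0 < n)%N.
Hypothesis v_ge0 : forall i s, 0 <= v i s.
Hypothesis welfare_le : forall o, welfare phi v0 v o <= Vmax.
Hypothesis v0_ge : forall o, - Vmax <= v0 o.

Lemma welfare_ge o : v0 o <= welfare phi v0 v o.
Proof. by rewrite lerDl sumr_ge0. Qed.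

Lemma Vmax_ge0 : 0 <= Vmax.
Proof.
by have := welfare_le ostar; have := welfare_ge ostar; have := v0_ge ostar; lra.
Qed.

Lemma vcg_utility_ge0 i : 0 <= vcg_utility phi v0 v ostar i.
Proof.
rewrite vcg_utilityE subr_ge0; apply: max_outcome_le => o.
apply: le_trans (welfare_le_max o).
by rewrite welfare_withoutE gerBl.
Qed.

(** The factor [n] comes from the welfare regret, which is scaled by it. At zero prices the agents
    together lose at most the welfare at [ostar] minus [v0 ostar], and the seller at most the
    welfare at [ostar] minus [v0 o], since VCG utilities are nonnegative. Both are at most
    [2 * Vmax]. *)
Lemma explore_round_regret o (q : 'I_n -> R) : (forall i, q i = 0) ->
  round_regret_le o q (2 * n%:R * Vmax).
Proof.
move=> q0; have V0 := Vmax_ge0.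
have le2n (x : R) : x <= 2 * Vmax -> x <= 2 * n%:R * Vmax.
  move=> xV; apply: le_trans xV _; rewrite -mulrA ler_wpM2l// ler_peMl//.
  by rewrite ler1n.
have := welfare_le ostar; have := welfare_ge o; have := v0_ge o.
have := welfare_ge ostar; have := v0_ge ostar => ? ? ? ? ?.
split.
- rewrite mulrAC mulrC ler_wpM2r//; lra.
- apply: le2n.
  apply: (@le_trans _ _ (\sum_(i < n) v i (phi i ostar))).
    apply: ler_sum => i _; rewrite q0 subr0.
    by have := vcg_utility_le i; have := v_ge0 i (phi i o); lra.
  have : \sum_(i < n) v i (phi i ostar) = welfare phi v0 v ostar - v0 ostar.
    by rewrite /welfare addrAC subrr add0r.
  lra.
- apply: le2n; rewrite big1 ?addr0; last by move=> i _; exact: q0.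
  have : vcg_seller_utility phi v0 v ostar <= welfare phi v0 v ostar.
    rewrite /vcg_seller_utility lerD2l; apply: ler_sum => i _.
    by have := vcg_utility_ge0 i; rewrite /vcg_utility; lra.
  lra.
Qed.

End explore.

Section exploit.
Variables (u f g c D : 'I_n -> S -> R) (cmax : R) (o : Omega) (q : 'I_n -> R).
Hypothesis n_gt0 : (0 < n)%N.
Hypothesis c_ge0 : forall i s, 0 <= c i s.
Hypothesis D_ge0 : forall i s, 0 <= D i s.
Hypothesis c_le : forall i s, c i s <= cmax.
Hypothesis u_ge : forall i s, v i s - D i s <= u i s.
Hypothesis u_le : forall i s, u i s <= v i s + (2 * c i s + D i s).
Hypothesis f_close : forall i s, `|f i s - v i s| <= 2 * c i s + D i s.
Hypothesis g_close : forall i s, `|g i s - v i s| <= 2 * c i s + D i s.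
Hypothesis o_max : is_argmax (welfare phi v0 u) o.
Hypothesis qE : forall i, q i = max_outcome o (welfare_without phi v0 f i)
  - welfare_without phi v0 g i o.

Let dev := \sum_(i < n) \sum_s D i s.
Let width o' := \sum_(i < n) c i (phi i o').

Let sum_D o' : \sum_(i < n) D i (phi i o') <= dev.
Proof.
apply: ler_sum => i _; rewrite (bigD1 (phi i o'))//= lerDl.
exact: sumr_ge0.
Qed.

Let sum_cD o' : \sum_(i < n) (2 * c i (phi i o') + D i (phi i o')) <=
  2 * width o' + dev.
Proof. by rewrite big_split /= -mulr_sumr lerD2l. Qed.

Let width_le o' : width o' <= n%:R * cmax.
Proof.
apply: le_trans (ler_sum _ (fun i _ => c_le i (phi i o'))) _.
by rewrite sumr_const card_ord mulr_natl.
Qed.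

Let cD_ge0 o' i : 0 <= 2 * c i (phi i o') + D i (phi i o').
Proof. by rewrite addr_ge0// mulr_ge0. Qed.

(** With [V] and [U] the welfare under [v] and [u]: [V(ostar) <= U(ostar) + dev <= U(o) + dev <=
    V(o) + 2 width o + 2 dev]. The width at [ostar] never enters. *)
Let welfare_gap : welfare phi v0 v ostar - welfare phi v0 v o <=
  2 * width o + 2 * dev.
Proof.
have := o_max ostar; have := sum_D ostar; have := sum_cD o.
have := @welfare_leD v u ostar (fun i => D i (phi i ostar)).
move=> /(_ (fun i => ltac:(by have := u_ge i (phi i ostar); lra))).
have := @welfare_leD u v o _ (fun i => u_le i (phi i o)).
lra.
Qed.

Let without_close h : (forall i s, `|h i s - v i s| <= 2 * c i s + D i s) ->
  forall i o', `|welfare_without phi v0 h i o' - welfare_without phi v0 v i o'|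
    <= 2 * width o' + dev.
Proof.
move=> hv i o'; have := sum_cD o'.
have le1 j : h j (phi j o') <= v j (phi j o') + (2 * c j (phi j o') + D j (phi j o')).
  by have := hv j (phi j o'); rewrite ler_norml; lra.
have le2 j : v j (phi j o') <= h j (phi j o') + (2 * c j (phi j o') + D j (phi j o')).
  by have := hv j (phi j o'); rewrite ler_norml; lra.
have := welfare_without_leD i (cD_ge0 o') le1.
have := welfare_without_leD i (cD_ge0 o') le2.
rewrite ler_norml; lra.
Qed.

(** The two maxima may be attained at any outcomes, hence the uniform width [cmax]. *)
Let max_close i : `|max_outcome o (welfare_without phi v0 f i)
    - max_outcome ostar (welfare_without phi v0 v i)| <= 2 * (n%:R * cmax) + dev.
Proof.
have h o' : `|welfare_without phi v0 f i o' - welfare_without phi v0 v i o'|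
    <= 2 * (n%:R * cmax) + dev.
  by apply: le_trans (without_close f_close i o') _; have := width_le o'; lra.
have F_le : max_outcome o (welfare_without phi v0 f i) <=
    max_outcome ostar (welfare_without phi v0 v i) + (2 * (n%:R * cmax) + dev).
  by apply: max_outcome_leD => o'; have := h o'; rewrite ler_norml; lra.
have V_le : max_outcome ostar (welfare_without phi v0 v i) <=
    max_outcome o (welfare_without phi v0 f i) + (2 * (n%:R * cmax) + dev).
  by apply: max_outcome_leD => o'; have := h o'; rewrite ler_norml; lra.
by rewrite ler_norml; lra.
Qed.

(** An agent's regret is the welfare gap, plus the error of the maximum in her price, plus the error
    of the others' welfare at [o]: at most [(2 width + 2 dev) + (2 n cmax + dev) + (2 width + dev)].
    The sum over agents gives the bound. *)
Lemma exploit_round_regret :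
  round_regret_le o q (4 * n%:R * width o + 2 * n%:R ^+ 2 * cmax + 4 * n%:R * dev).
Proof.
have n0 : 0 <= n%:R :> R by [].
have width0 : 0 <= width o by exact: sumr_ge0.
have dev0 : 0 <= dev by apply: sumr_ge0 => i _; exact: sumr_ge0.
have ncmax0 : 0 <= n%:R * cmax by exact: le_trans (width_le o).
have gap := welfare_gap.
have gc i := without_close g_close i o; have mc i := max_close i.
have le_const (F : 'I_n -> R) : (forall i, F i <=
       4 * width o + 2 * (n%:R * cmax) + 4 * dev) ->
    \sum_(i < n) F i <=
    4 * n%:R * width o + 2 * n%:R ^+ 2 * cmax + 4 * n%:R * dev.
  move=> FB; apply: le_trans (ler_sum _ (fun i _ => FB i)) _.
  by rewrite sumr_const card_ord -mulr_natl; lra.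
split.
- rewrite mulr_natl -[X in _ *+ X]card_ord -sumr_const; apply: le_const => i.
  lra.
- apply: le_const => i; rewrite vcg_utilityE qE.
  have := gc i; have := mc i; rewrite !ler_norml (welfare_withoutE v i o).
  lra.
- apply: le_trans (le_const (fun i =>
    (max_outcome ostar (welfare_without phi v0 v i)
      - max_outcome o (welfare_without phi v0 f i))
    + (welfare_without phi v0 g i o - welfare_without phi v0 v i o)) _); last first.
    by move=> i; have := gc i; have := mc i; rewrite !ler_norml; lra.
  rewrite big_split !sumrB /= sum_welfare_without /vcg_seller_utility.
  under [X in _ - (_ + X)]eq_bigr do rewrite qE.
  rewrite sumrB /vcg_price sumrB sum_welfare_without.
  have n1 : 0 <= n%:R - 1 :> R by rewrite subr_ge0 ler1n.
  have := welfare_le_max o; rewrite -subr_ge0 => /(mulr_ge0 n1).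
  lra.
Qed.

End exploit.

End round_regret.

(** * An exponential supermartingale *)

Lemma ge0_integral_mrestr d (T : measurableType d) (R : realType)
    (mu : {measure set T -> \bar R}) (D : set T) (mD : measurable D)
    (f : T -> \bar R) :
  measurable_fun setT f -> (forall x, 0 <= f x)%E ->
  (\int[mrestr mu mD]_x f x = \int[mu]_(x in D) f x)%E.
Proof.
move=> mf f0; have mDC := measurableC mD.
rewrite -(setvU D) setUC ge0_integral_setU//; last 2 first.
- by rewrite setUv.
- by apply/disj_setPCl.
rewrite [X in (_ + X)%E](_ : _ = 0%E) ?adde0.
  apply: eq_measure_integral => A mA AD.
  by change (mu (A `&` D) = mu A); rewrite setIidl.
rewrite (@eq_measure_integral _ _ _ _ mzero).
  by rewrite integral_measure_zero.
move=> A mA AD; change (mu (A `&` D) = 0%E).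
rewrite (_ : A `&` D = set0) ?measure0//.
by apply/seteqP; split => // x [/AD].
Qed.

Section weighted_independence.
Context d (T : measurableType d) (R : realType) (P : probability T R).
Context (G : set (set T)) (D : set T) (Z : {RV P >-> R}).
Context (nu : probability (measurableTypeR R) R).
Hypothesis mG : forall A, <<s G >> A -> measurable A.
Hypothesis mD : measurable D.
Hypothesis PGZ : forall (H : set T) (B : set R), <<s G >> H -> measurable B ->
  (P (H `&` D `&` Z @^-1` B) = P (H `&` D) * nu B)%E.

Local Notation TG := (g_sigma_algebraType G).

(** The hypothesis factorises events only. By uniqueness of product measures, the law of [(x, Z x)]
    under [P] restricted to [D], with [x] seen through the coarser sigma-algebra generated by [G],
    is a product; Tonelli then factorises integrals. *)
Lemma weighted_independence (W : TG -> \bar R) (h : measurableTypeR R -> \bar R) :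
  measurable_fun setT W -> measurable_fun setT h ->
  (forall x, 0 <= W x)%E -> (forall y, 0 <= h y)%E ->
  (\int[P]_(x in D) (W x * h (Z x)) = \int[P]_(x in D) W x * \int[nu]_y h y)%E.
Proof.
move=> mW mh W0 h0.
pose forget (x : T) : TG := x.
have mforget : measurable_fun setT forget.
  by move=> _ A mA; rewrite setTI; exact: mG.
have mZ : measurable_fun setT (Z : T -> measurableTypeR R).
  by move=> mT B mB; exact: (@measurable_funPT _ _ _ _ Z mT B mB).
pose with_Z (x : T) : (TG * measurableTypeR R)%type := (forget x, Z x).
have mwith_Z : measurable_fun setT with_Z.
  exact: (measurable_fun_pair mforget mZ).
(* The measure structure on a pushforward takes a proof of measurability, which
   unification cannot guess. *)
pose PD0 : {measure set TG -> \bar R} :=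
  measure_function_pushforward__canonical__measure_function_Measure
    (mrestr P mD) mforget.
have fin_num_PD : fin_num_fun PD0.
  move=> A mA; apply: fin_num_measure.
  by have := mforget measurableT A mA; rewrite setTI.
pose PD : {finite_measure set TG -> \bar R} :=
  HB.pack (Measure.sort PD0) (Measure_isFinite.Build _ _ _ _ fin_num_PD).
pose law : {measure set (TG * measurableTypeR R)%type -> \bar R} :=
  measure_function_pushforward__canonical__measure_function_Measure (mrestr P mD) mwith_Z.
have lawE A : measurable A -> (PD \x nu)%E A = law A.
  apply: product_measure_unique => H B mH mB.
  change (P ((forget @^-1` H `&` Z @^-1` B) `&` D) =
    P (forget @^-1` H `&` D) * nu B)%E.
  by rewrite setIAC; exact: PGZ.
pose g (z : (TG * measurableTypeR R)%type) : \bar R := (W z.1 * h z.2)%E.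
have mg : measurable_fun setT g.
  by apply: emeasurable_funM; exact: measurableT_comp.
have g0 z : (0 <= g z)%E by exact: mule_ge0.
transitivity (\int[law]_z g z)%E.
  rewrite /law ge0_integral_pushforward//=.
  by rewrite preimage_setT ge0_integral_mrestr//=; exact: measurableT_comp.
rewrite (@eq_measure_integral _ _ _ _ (PD \x nu)%E); last first.
  by move=> A mA _; rewrite -lawE.
rewrite fubini_tonelli1//=.
under eq_integral do rewrite /fubini_F /g /= ge0_integralZl//.
rewrite ge0_integralZr//; last by apply: integral_ge0.
congr (_ * _)%E.
rewrite (@eq_measure_integral _ _ _ _ PD0)//.
rewrite /PD0 ge0_integral_pushforward//=.
by rewrite preimage_setT ge0_integral_mrestr//=; exact: measurableT_comp.
Qed.
End weighted_independence.

Section mean_le.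
Context d (T : measurableType d) (R : realType) (P : probability T R).
Implicit Types (f g : T -> R) (c k : R).

(* Bounds the mean from above by a nonnegative measurable majorant, so that the
   prices need not be shown measurable. *)
Definition mean_le f c : Prop :=
  exists g, [/\ measurable_fun setT g, forall x, 0 <= g x,
    forall x, f x <= g x & (\int[P]_x (g x)%:E <= c%:E)%E].

Lemma mean_le_weaken f g c k :
  mean_le g c -> (forall x, f x <= g x) -> c <= k -> mean_le f k.
Proof.
move=> [h [mh h0 gh hc]] fg ck; exists h; split => //.
  by move=> x; exact: le_trans (gh x).
by apply: (le_trans hc); rewrite lee_fin.
Qed.

Lemma mean_le_cst c : 0 <= c -> mean_le (fun=> c) c.
Proof.
move=> c0; exists (fun=> c); split => //.
rewrite (@integral_cst _ _ _ P _ measurableT c%:E).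
by rewrite [X in (_ * X)%E](_ : _ = 1%E) ?mule1//; exact: probability_setT.
Qed.

Lemma mean_leD f g c k : mean_le f c -> mean_le g k ->
  mean_le (fun x => f x + g x) (c + k).
Proof.
move=> [f' [mf f0 ff fc]] [g' [mg g0 gg gk]].
exists (fun x => f' x + g' x); split => [|x|x|].
- exact: measurable_funD.
- exact: addr_ge0.
- exact: lerD.
- under eq_integral do rewrite EFinD.
  rewrite ge0_integralD//; try by move=> x _; rewrite lee_fin.
  + by rewrite EFinD; exact: leeD.
  + exact/measurable_EFinP.
  + exact/measurable_EFinP.
Qed.

Lemma mean_leZ f c k : 0 <= k -> mean_le f c -> mean_le (fun x => k * f x) (k * c).
Proof.
move=> k0 [g [mg g0 fg gc]].
exists (fun x => k * g x); split => [|x|x|].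
- exact: measurable_funM.
- exact: mulr_ge0.
- exact: ler_wpM2l.
- under eq_integral do rewrite EFinM.
  rewrite ge0_integralZl_EFin//; last first.
  + exact/measurable_EFinP.
  + by move=> x _; rewrite lee_fin.
  + by rewrite EFinM; apply: lee_wpmul2l; rewrite ?lee_fin.
Qed.

Lemma mean_le_sum (I : Type) (s : seq I) (p : pred I) (f : I -> T -> R)
    (c : I -> R) : (forall i, p i -> mean_le (f i) (c i)) ->
  mean_le (fun x => \sum_(i <- s | p i) f i x) (\sum_(i <- s | p i) c i).
Proof.
move=> fc; elim: s => [|i s IH].
  rewrite big_nil; apply: mean_le_weaken (mean_le_cst (lexx 0)) _ _ => // x.
  by rewrite big_nil.
rewrite big_cons; case: ifPn => pi; last first.
  by apply: mean_le_weaken IH _ _ => // x; rewrite big_cons (negbTE pi).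
by apply: mean_le_weaken (mean_leD (fc i pi) IH) _ _ => // x; rewrite big_cons pi.
Qed.

(** Valid for any [f], measurable or not: the integral of a nonnegative function is a supremum over
    the simple functions below it, hence monotone, and discarding the negative part of [f] can only
    increase the value. *)
Lemma expectation_mean_le f c : mean_le f c -> ('E_P[f] <= c%:E)%E.
Proof.
move=> [g [mg g0 fg gc]]; rewrite unlock; apply: le_trans gc.
rewrite integralE; apply: (@le_trans _ _ (\int[P]_x ((EFin \o f)^\+ x))%E).
  by rewrite -[leRHS]sube0; apply: leeB => //; exact: integral_ge0.
rewrite ge0_integralTE; last by move=> x; exact: funepos_ge0.
rewrite ge0_integralTE; last by move=> x; rewrite lee_fin.
apply: le_ereal_sup => _ /= [h hf <-]; exists h => // x.
apply: le_trans (hf x) _; rewrite funeposE ge_max !lee_fin fg.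
exact: g0.
Qed.

End mean_le.

Section supermartingale.
Context (R : realType) (n : nat) (Omega S : finType).
Context (phi : 'I_n -> Omega -> S) (sigma : R) (v : 'I_n -> S -> R).
Context (d : measure_display) (Xi : measurableType d) (P : probability Xi R).
Context (nu : 'I_n -> S -> probability (measurableTypeR R) R).
Context (w : nat -> Xi -> Omega) (X : 'I_n -> nat -> {RV P >-> R}).
Hypothesis bandit : bandit_rewards phi nu w X.
Hypothesis sub_gauss : forall i s, sub_gaussian sigma (nu i s) (v i s).

(** [flag] depends on the round number alone and [w l] is known before the reward, so the branch is
    settled before [X i l] is drawn. *)
Definition exp_increment (lam : R) i s (flag : nat -> bool) (l : nat) (x : Xi) : R :=
  if flag l && (phi i (w l x) == s)
  then expR (lam * (X i l x - v i s) - lam ^+ 2 * sigma ^+ 2 / 2) else 1.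

Definition exp_supermartingale lam i s flag (t : nat) (x : Xi) : R :=
  \prod_(1 <= l < t) exp_increment lam i s flag l x.

Let history_generator (t : nat) : set (set Xi) :=
  [set A | (exists l o, (0 < l <= t)%N /\ A = w l @^-1` [set o]) \/
           (exists i l (B : set R),
              [/\ (0 < l < t)%N, measurable B & A = X i l @^-1` B])].

Let measurable_history t A : history w X t A -> measurable A.
Proof.
apply: (@smallest_sub _ (sigma_algebra setT) _ (measurable : set (set Xi))).
  exact: sigma_algebra_measurable.
move=> _ /= [[l [ o' [/andP[l0 _] ->]]]|[i [l [B [_ mB ->]]]]].
  by case: bandit => + _; apply.
by rewrite -[_ @^-1` _]setTI; exact: measurable_funPT.
Qed.

Lemma exp_increment_ge0 lam i s flag l x : 0 <= exp_increment lam i s flag l x.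
Proof. by rewrite /exp_increment; case: ifP => // _; exact: expR_ge0. Qed.

Lemma exp_supermartingale_ge0 lam i s flag t x :
  0 <= exp_supermartingale lam i s flag t x.
Proof. by apply: prodr_ge0 => l _; exact: exp_increment_ge0. Qed.

Lemma history_measurable_exp_supermartingale lam i s flag t :
  measurable_fun setT
    (exp_supermartingale lam i s flag t
       : g_sigma_algebraType (history_generator t) -> R).
Proof.
apply: measurable_prod => l; rewrite mem_index_iota => /andP[l0 lt].
apply: measurable_fun_ifT => //.
- apply: (@measurable_fun_bool _ _ _ _ true).
  case: (flag l) => /=; last first.
    rewrite (_ : _ `&` _ = set0) //.
    by apply/seteqP; split => // x [].
  rewrite (_ : _ `&` _ =
      \big[setU/set0]_(o | phi i o == s) (w l @^-1` [set o])).
    apply: bigsetU_measurable => o _; apply: sub_sigma_algebra.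
    by left; exists l, o; split => //; rewrite l0 ltnW.
  rewrite -bigcup_seq_cond; apply/seteqP; split => x /=.
    by case=> _ wx; exists (w l x) => //=; rewrite mem_index_enum.
  by case=> o /andP[_ os] /= wx; split; rewrite // wx.
- apply: measurableT_comp => //; apply: measurable_funB => //.
  apply: measurable_funM => //; apply: measurable_funB => //.
  move=> _ B mB; rewrite setTI; apply: sub_sigma_algebra; right.
  by exists i, l, B; rewrite l0 lt.
Qed.

Lemma measurable_exp_supermartingale lam i s flag t :
  measurable_fun setT (exp_supermartingale lam i s flag t : Xi -> R).
Proof.
move=> _ B mB; apply: (@measurable_history t).
exact: history_measurable_exp_supermartingale.
Qed.

(** Splitting on the finitely many outcomes of the last round replaces conditioning. On each piece
    the last increment is either 1 or independent of the past, with a mean that sub-Gaussianity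
    bounds by 1. *)
Lemma integral_exp_supermartingale lam i s flag t :
  (\int[P]_x (exp_supermartingale lam i s flag t x)%:E <= 1)%E.
Proof.
have int1 : (\int[P]_x 1%:E <= (1 : \bar R))%E.
  rewrite (@integral_cst _ _ _ P _ measurableT 1%:E) mul1e.
  exact: probability_le1.
elim: t => [|[|t] IH].
- by under eq_integral do rewrite /exp_supermartingale big_geq//.
- by under eq_integral do rewrite /exp_supermartingale big_geq//.
set M := exp_supermartingale lam i s flag t.+1.
have split_outcome (f : Xi -> \bar R) : measurable_fun setT f ->
    (forall x, 0 <= f x)%E ->
    (\int[P]_x f x = \sum_(o : Omega) \int[P]_(x in w t.+1 @^-1` [set o]) f x)%E.
  move=> mf f0.
  have wT : \big[setU/set0]_(o : Omega) (w t.+1 @^-1` [set o]) = setT.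
    apply/seteqP; split => // x _.
    by rewrite -bigcup_seq; exists (w t.+1 x) => //=; rewrite mem_index_enum.
  rewrite -{1}wT ge0_integral_bigsetU//.
  - by move=> o; case: bandit => + _; apply.
  - exact: index_enum_uniq.
  - by apply/trivIsetP => o o' _ _ oo'; apply/seteqP; split => //
      x /= [-> /eqP]; rewrite (negbTE oo').
  - by rewrite wT.
rewrite split_outcome; last 2 first.
- by apply/measurable_EFinP; exact: measurable_exp_supermartingale.
- by move=> x; rewrite lee_fin; exact: exp_supermartingale_ge0.
apply: le_trans IH; rewrite (split_outcome (fun x => (M x)%:E)); last 2 first.
- by apply/measurable_EFinP; exact: measurable_exp_supermartingale.
- by move=> x; rewrite lee_fin; exact: exp_supermartingale_ge0.
apply: lee_sum => o _.
have ME x : exp_supermartingale lam i s flag t.+2 x =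
  M x * exp_increment lam i s flag t.+1 x.
  by rewrite /exp_supermartingale big_nat_recr.
have [used|notused] := boolP (flag t.+1 && (phi i o == s)); last first.
  rewrite le_eqVlt; apply/orP; left; apply/eqP/eq_integral => x.
  by rewrite inE /= => wo; rewrite ME /exp_increment wo (negbTE notused) mulr1.
pose h (y : measurableTypeR R) : \bar R :=
  (expR (lam * (y - v i s) - lam ^+ 2 * sigma ^+ 2 / 2))%:E.
rewrite (_ : (\int[P]_(x in w t.+1 @^-1` [set o])
    (exp_supermartingale lam i s flag t.+2 x)%:E =
  \int[P]_(x in w t.+1 @^-1` [set o]) ((M x)%:E * h (X i t.+1 x)))%E); last first.
  apply: eq_integral => x; rewrite inE /= => wo.
  by rewrite ME /exp_increment wo used EFinM.
have mD : measurable (w t.+1 @^-1` [set o]) by case: bandit => + _; apply.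
have mh : measurable_fun setT h.
  apply/measurable_EFinP; apply: measurableT_comp => //.
  apply: measurable_funB => //; apply: measurable_funM => //.
  exact: measurable_funB.
have PGZ (H : set Xi) (B : set R) : history w X t.+1 H -> measurable B ->
    (P (H `&` w t.+1 @^-1` [set o] `&` X i t.+1 @^-1` B) =
     P (H `&` w t.+1 @^-1` [set o]) * nu i s B)%E.
  (* Leaving the other agents' rewards unconstrained extracts the marginal law of agent [i] from the
     joint law. *)
  move=> hH mB; pose C j : set R := if j == i then B else setT.
  have mC j : measurable (C j) by rewrite /C; case: ifP.
  have := (proj2 bandit) t.+1 o H C isT hH mC.
  rewrite (_ : [set x | forall j, C j (X j t.+1 x)] = X i t.+1 @^-1` B).
    move=> ->; rewrite (bigD1 i)//= /C eqxx big1 ?mule1//.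
      by case/andP: used => _ /eqP ->.
    by move=> j /negbTE ->; exact: probability_setT.
  rewrite /C; apply/seteqP; split => x /=; first by move/(_ i); rewrite eqxx.
  by move=> xB j; case: eqP => [->|].
have M0 x : (0 <= (M x)%:E)%E by rewrite lee_fin; exact: exp_supermartingale_ge0.
have mM : measurable_fun setT
    ((EFin \o M) : g_sigma_algebraType (history_generator t.+1) -> \bar R).
  by apply/measurable_EFinP; exact: history_measurable_exp_supermartingale.
have h0 y : (0 <= h y)%E by rewrite lee_fin expR_ge0.
rewrite (weighted_independence (@measurable_history t.+1) mD PGZ mM mh)//.
rewrite -[leRHS]mule1; apply: lee_wpmul2l.
  by apply: integral_ge0 => x _; rewrite lee_fin; exact: exp_supermartingale_ge0.
have mexp : measurable_fun setT
    (fun y : measurableTypeR R => (expR (lam * (y - v i s)))%:E).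
  apply/measurable_EFinP; apply: measurableT_comp => //.
  by apply: measurable_funM => //; exact: measurable_funB.
rewrite /h; under eq_integral do rewrite expRD EFinM muleC.
rewrite ge0_integralZl_EFin ?expR_ge0//.
apply: le_trans (lee_wpmul2l _ (sub_gauss i s lam)) _.
  by rewrite lee_fin expR_ge0.
by rewrite -EFinM -expRD addNr expR0.
Qed.

End supermartingale.

(** * Numbers of used reports *)

Lemma inv_sqrt_le (R : realType) (m : nat) :
  (Num.sqrt (m.+1%:R : R))^-1 <= 2 * Num.sqrt m.+1%:R - 2 * Num.sqrt m%:R.
Proof.
have := sqr_sqrtr (ler0n R m); have := sqr_sqrtr (ler0n R m.+1).
have := sqrtr_ge0 (m%:R : R).
have : 0 < Num.sqrt (m.+1%:R : R) by rewrite sqrtr_gt0.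
rewrite -(natr1 m).
move: (Num.sqrt _) (Num.sqrt _) => b a b0 a0 b2 a2.
by rewrite -div1r ler_pdivrMr//; nra.
Qed.

Lemma sum_inv_sqrt_le (R : realType) (m : nat) :
  \sum_(1 <= k < m.+1) (Num.sqrt (k%:R : R))^-1 <= 2 * Num.sqrt m%:R.
Proof.
elim: m => [|m IH]; first by rewrite big_geq// sqrtr0 mulr0.
by rewrite big_nat_recr//=; have := inv_sqrt_le R m; lra.
Qed.

Section counts.
Context (R : realType) (n : nat) (Omega S : finType) (phi : 'I_n -> Omega -> S).
Context (K : nat) (e : 'I_K -> Omega) (sel : nat -> 'I_n -> S -> 'I_K).
Context (est : est_mode) (w : nat -> Omega).
Hypothesis K_gt0 : (0 < K)%N.
Local Notation start := (bracket_start R K).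
Local Notation used := (used_round R phi sel est w).
Local Notation count := (num_used R phi sel est w).

Lemma num_usedS i t s : (0 < t)%N -> count i t.+1 s = (count i t s + used i s t)%N.
Proof.
by move=> t0; rewrite /num_used big_mkcond big_nat_recr//= -big_mkcond.
Qed.

Lemma num_used_le i t t' s : (t <= t')%N -> (count i t s <= count i t' s)%N.
Proof.
elim: t' => [|t' IH]; first by rewrite leqn0 => /eqP ->.
rewrite leq_eqVlt => /predU1P[->//|/IH tt'].
case: t' {IH} tt' => [|t'] tt'; last by rewrite num_usedS// (leq_trans tt')// leq_addr.
by rewrite (leq_trans tt')// /num_used big_geq.
Qed.

Lemma sum_num_used_le i t : (\sum_s count i t.+1 s <= t)%N.
Proof.
elim: t => [|t IH]; first by rewrite big1// => s _; rewrite /num_used big_geq.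
under eq_bigr do rewrite num_usedS//.
rewrite big_split /= -[leqRHS]addn1 leq_add//.
rewrite (bigD1 (phi i (w t.+1)))//= big1 ?addn0 ?leq_b1// => s sw.
by rewrite /used_round eq_sym (negbTE sw).
Qed.

Lemma num_used_lt i t s : (count i t.+1 s <= t)%N.
Proof.
by apply: leq_trans (sum_num_used_le i t); rewrite (bigD1 s)//= leq_addr.
Qed.

Lemma bracket_start_mono q q' : (0 < q < q')%N -> (start q + K <= start q')%N.
Proof.
case: q' => [|q']; rewrite ?andbF// => /andP[q0].
elim: q' => [|q' IH]; first by rewrite ltnS leqNgt q0.
rewrite ltnS leq_eqVlt => /predU1P[<-|/IH qq'].
  by rewrite bracket_startS// leq_addr.
by apply: (leq_trans qq'); rewrite (@bracket_startS _ _ q'.+1)// -addnA leq_addr.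
Qed.

Lemma exploit_roundN_explore q t : (0 < q)%N -> (start q + K < t <= start q.+1)%N ->
  ~~ explore_round R K t.
Proof.
move=> q0 /andP[qt tq]; apply/hasPn => q'; rewrite mem_iota => /andP[q'0 _].
apply/negP => /andP[lt le].
have [q'q|qq'|q'q] := ltngtP q' q.
- have : (0 < q' < q)%N by rewrite q'0 q'q.
  by move=> /bracket_start_mono; lia.
- have [q'E|] := eqVneq q' q.+1; first by rewrite q'E in lt; lia.
  move=> ne; have : (0 < q.+1 < q')%N by rewrite /=; lia.
  by move=> /bracket_start_mono; lia.
- by rewrite q'q in le; lia.
Qed.

Section explored.
Hypothesis sel_valid : valid_selection phi e sel.
Hypothesis explore : forall q (r : 'I_K), (0 < q)%N -> w (start q + r.+1)%N = e r.

Lemma num_used_ge q i t s : (start q + K < t)%N -> (q <= count i t s)%N.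
Proof.
elim: q t => // q IH t qt.
pose l := (start q.+1 + (sel q.+1 i s).+1)%N.
have lt : (l < t)%N by rewrite (leq_ltn_trans _ qt)// leq_add2l ltn_ord.
(* [selected_round] searches brackets only up to the round number, so the index [q.+1] must not
   exceed [l]. *)
have ql : (q < l)%N.
  have := bracket_start_ge R K q; have := leq_pmulr q K_gt0.
  by rewrite /l; lia.
apply: leq_trans (num_used_le i s lt).
rewrite num_usedS//; last by lia.
have -> : used i s l.
  rewrite /used_round explore// sel_valid eqxx /=; apply/orP; left.
  by apply/hasP; exists q.+1 => //; rewrite mem_iota; lia.
rewrite addn1 ltnS; case: (posnP q) => [->//|q0].
apply: IH; rewrite (leq_ltn_trans (bracket_start_mono (q' := q.+1) _))//.
  by rewrite q0 /=.
by rewrite /l addnS ltnS leq_addr.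
Qed.

End explored.

Lemma sum_inv_sqrt_num_used_le i (exploited : pred nat) T :
  (forall t, (0 < t)%N -> exploited t ->
     used i (phi i (w t)) t && (0 < count i t (phi i (w t)))%N) ->
  \sum_(1 <= t < T.+1 | exploited t)
    (Num.sqrt ((count i t (phi i (w t)))%:R : R))^-1
  <= 2 * Num.sqrt (#|S|%:R * T%:R).
Proof.
move=> h.
(* Every exploit round raises the potential sum_s 2 sqrt (N_s - 1) by at least
   its own 1 / sqrt N, as N_s >= 1 when it starts. *)
have potential : \sum_(1 <= t < T.+1 | exploited t)
    (Num.sqrt ((count i t (phi i (w t)))%:R : R))^-1
    <= \sum_s 2 * Num.sqrt ((count i T.+1 s).-1%:R : R).
  elim: T => [|T IH].
    by rewrite big_geq// sumr_ge0// => s _; rewrite mulr_ge0// sqrtr_ge0.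
  have mono s : Num.sqrt ((count i T.+1 s).-1%:R : R) <=
      Num.sqrt ((count i T.+2 s).-1%:R : R).
    rewrite ler_sqrt// ler_nat.
    by have := num_used_le i s (leqnSn T.+1); lia.
  rewrite big_mkcond big_nat_recr//= -big_mkcond.
  case: ifPn => [|_]; last first.
    rewrite addr0; apply: le_trans IH _; apply: ler_sum => s _.
    by rewrite ler_wpM2l.
  move=> /(h T.+1 isT) /andP[]; set s := phi i (w T.+1) => us Ns.
  rewrite (bigD1 s)//= in IH; rewrite [leRHS](bigD1 s)//=.
  have rest : \sum_(s' | s' != s) 2 * Num.sqrt ((count i T.+1 s').-1%:R : R) <=
      \sum_(s' | s' != s) 2 * Num.sqrt ((count i T.+2 s').-1%:R : R).
    by apply: ler_sum => s' _; rewrite ler_wpM2l.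
  have -> : (count i T.+2 s).-1 = count i T.+1 s by rewrite num_usedS// us addn1.
  case: (count i T.+1 s) Ns IH => // m _ IH.
  by have := inv_sqrt_le R m; rewrite /= in IH; lra.
apply: (le_trans potential).
have := sum_num_used_le i T; rewrite -(ler_nat R) natr_sum => sumN.
set A := #|S|%:R * T%:R; have A0 : 0 <= A by rewrite mulr_ge0.
have Ssize : 0 < #|S|%:R :> R.
  by rewrite ltr0n; apply/card_gt0P; exists (phi i (w 0)).
have [T0|T_gt0] := posnP T.
  rewrite big1 ?mulr_ge0 ?sqrtr_ge0// => s _.
  by have := num_used_lt i T s; rewrite T0 leqn0 => /eqP ->; rewrite sqrtr0 mulr0.
have Apos : 0 < Num.sqrt A by rewrite sqrtr_gt0 mulr_gt0// ltr0n.
rewrite -mulr_sumr ler_pM2l// -(ler_pM2l Apos) -expr2 sqr_sqrtr// mulr_sumr.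
(* Cauchy-Schwarz as a termwise AM-GM: since the counts add up to at most [T], the right sides sum
   to at most [#|S| * T], the square of [Num.sqrt A]. *)
have amgm s : Num.sqrt A * Num.sqrt (count i T.+1 s).-1%:R <=
    (#|S|%:R * (count i T.+1 s)%:R + T%:R) / 2 :> R.
  have N1 : (count i T.+1 s).-1%:R <= (count i T.+1 s)%:R :> R.
    by rewrite ler_nat leq_pred.
  have := sqr_sqrtr (ler0n R (count i T.+1 s).-1).
  have := sqr_sqrtr (ler0n R T); have := sqr_sqrtr (ltW Ssize).
  rewrite /A sqrtrM ?(ltW Ssize)//.
  move: (Num.sqrt _) (Num.sqrt _) (Num.sqrt _) => a b x a2 b2 x2.
  have := sqr_ge0 (a * x - b); rewrite sqrrB exprMn a2 b2 x2.
  have := ler_wpM2l (ltW Ssize) N1; lra.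
apply: le_trans (ler_sum _ (fun s _ => amgm s)) _.
rewrite -mulr_suml big_split /= -mulr_sumr sumr_const -[T%:R *+ _]mulr_natl.
have := ler_wpM2l (ltW Ssize) sumN.
rewrite /A; lra.
Qed.

End counts.

(** * Deviations of the estimates *)

(** [lam] is the Chernoff optimum: the width times [lam N] is [a], while [lam^2 sigma^2 N / 2] is
    [a / 2]. Applying [y <= exp y] to [y = lam |Z| - a] gives the exponential, and the two summands
    cover the two signs of [Z]. [1 <= a] serves in [1 / (lam N) <= sigma / sqrt N]. *)
Lemma deviation_le_exp (R : realType) (sigma a Z lam : R) (N : nat) :
  0 < sigma -> 1 <= a -> (0 < N)%N ->
  lam = Num.sqrt a / (sigma * Num.sqrt N%:R) ->
  `|Z| / N%:R - sigma * Num.sqrt (a / N%:R) <=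
  sigma / Num.sqrt N%:R * expR (- (a / 2)) *
    (expR (lam * Z - lam ^+ 2 * sigma ^+ 2 / 2 * N%:R)
     + expR (- lam * Z - (- lam) ^+ 2 * sigma ^+ 2 / 2 * N%:R)).
Proof.
move=> s0 a1 N0 lamE.
have a0 : 0 < a by lra.
have Npos : 0 < N%:R :> R by rewrite ltr0n.
have := sqr_sqrtr (ltW a0); have := sqr_sqrtr (ltW Npos).
have : 0 < Num.sqrt a by rewrite sqrtr_gt0.
have : 0 < Num.sqrt (N%:R : R) by rewrite sqrtr_gt0.
rewrite sqrtrM ?(ltW a0)// sqrtrV ?(ltW Npos)//.
move: (Num.sqrt _) (Num.sqrt _) lamE => y x lamE y0 x0 y2 x2.
have lam0 : 0 < lam by rewrite lamE divr_gt0// mulr_gt0.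
have x1 : 1 <= x.
  rewrite leNgt; apply/negP => xlt; have : x * x < 1.
    by apply: mulr_ilt1 => //; exact: ltW.
  by rewrite -expr2 x2; lra.
have lamN : lam ^+ 2 * sigma ^+ 2 / 2 * N%:R = a / 2.
  by rewrite -x2 -y2 lamE; field; rewrite !lt0r_neq0.
rewrite sqrrN lamN.
have step : `|Z| / N%:R - sigma * (x / y) <= expR (lam * `|Z| - a) / (lam * N%:R).
  rewrite ler_pdivlMr ?mulr_gt0//.
  have -> : (`|Z| / N%:R - sigma * (x / y)) * (lam * N%:R) = lam * `|Z| - a.
    by rewrite -x2 -y2 lamE; field; rewrite !lt0r_neq0.
  by have := expR_ge1Dx (lam * `|Z| - a); lra.
apply: (le_trans step).
have -> : lam * `|Z| - a = - (a / 2) + (lam * `|Z| - a / 2) by lra.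
set E := expR (lam * `|Z| - a / 2).
have E_le : E <= expR (lam * Z - a / 2) + expR (- lam * Z - a / 2).
  rewrite /E; have [Z0|Z0] := leP 0 Z.
    by rewrite ger0_norm// lerDl expR_ge0.
  by rewrite ltr0_norm// mulrN -mulNr lerDr expR_ge0.
rewrite expRD -/E.
have e0 := expR_ge0 (- (a / 2)).
have E0 : 0 <= E := expR_ge0 _.
have inv_le : (lam * N%:R)^-1 <= sigma / y.
  have -> : (lam * N%:R)^-1 = sigma / y / x.
    by rewrite -y2 lamE; field; rewrite !lt0r_neq0.
  by rewrite ler_pdivrMr// ler_peMr// divr_ge0// ltW.
rewrite mulrC mulrA; apply: ler_pM => //.
- by rewrite mulr_ge0// invr_ge0 mulr_ge0// ltW.
- by rewrite ler_wpM2r.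
Qed.

Section conf_log_bounds.
Context (R : realType) (S : finType) (K : nat).
Local Notation start := (bracket_start R K).

Definition conf_log (q t : nat) : R :=
  5 * ln ((t - q * K + 1)%:R : R) + 2 * ln (#|S|%:R : R).

Hypothesis S_gt0 : (0 < #|S|)%N.
Variables (q t T : nat).
Hypotheses (q_gt0 : (0 < q)%N) (K_gt0 : (0 < K)%N).
Hypothesis qt : (start q + K < t <= T)%N.
Let tau := (t - q * K + 1)%N.

Let tau_itv : (1 < tau <= T)%N.
Proof.
have qK : (q * K = q.-1 * K + K)%N by rewrite -mulSnr prednK.
have := bracket_start_ge R K q.-1; rewrite prednK// => start_ge.
move: qt start_ge K_gt0 => /andP[tgt tT]; rewrite /tau qK.
by move: (q.-1 * K)%N (start q) tgt => m c; lia.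
Qed.

Lemma conf_log_le : conf_log q t <= 5 * ln (#|S| * T)%:R.
Proof.
have /andP[tau1 tauT] := tau_itv.
rewrite natrM lnM ?posrE ?ltr0n//; last by lia.
have : ln (tau%:R : R) <= ln T%:R.
  by rewrite ler_ln ?posrE ?ltr0n ?ler_nat//; lia.
have : 0 <= ln (#|S|%:R : R) by rewrite ln_ge0// ler1n.
rewrite /conf_log -/tau; lra.
Qed.

(** An exploit round has [tau >= 2], and [2^5] exceeds [e]. *)
Lemma conf_log_ge1 : 1 <= conf_log q t.
Proof.
have /andP[tau1 tauT] := tau_itv.
have : 1 <= ln ((tau ^ 5)%:R : R).
  apply: ln_ge1; apply: (@leq_trans (2 ^ 5)%N) => //.
  by rewrite leq_exp2r.
rewrite natrX lnXn ?ltr0n; last by lia.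
have : 0 <= ln (#|S|%:R : R) by rewrite ln_ge0// ler1n.
rewrite -[ln _ *+ _]mulr_natl /conf_log -/tau.
by move: (ln _) (ln _) => a c; lra.
Qed.

(** The exact value is [tau^(-5/2) / |S|]. Half a power of [tau] is given up; the rest is summable
    over rounds, and [1 / |S|] pays for the sum over allocations. *)
Lemma expR_conf_log : expR (- (conf_log q t / 2)) <= (tau%:R ^+ 2 * #|S|%:R)^-1.
Proof.
have /andP[tau1 tauT] := tau_itv.
have tau0 : 0 < tau%:R :> R by rewrite ltr0n; lia.
have S0 : 0 < #|S|%:R :> R by rewrite ltr0n.
have -> : (tau%:R ^+ 2 * #|S|%:R)^-1 = expR (- (2 * ln tau%:R + ln #|S|%:R)) :> R.
  by rewrite expRN expRD lnK ?posrE// expRM_natl lnK ?posrE.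
rewrite ler_expR.
have : 0 <= ln (tau%:R : R).
  by rewrite ln_ge0// ler1n; lia.
rewrite /conf_log -/tau; lra.
Qed.

End conf_log_bounds.

Section deviation.
Context (R : realType) (n : nat) (Omega S : finType) (phi : 'I_n -> Omega -> S).
Context (sigma : R) (v : 'I_n -> S -> R).
Context (K : nat) (e : 'I_K -> Omega) (sel : nat -> 'I_n -> S -> 'I_K).
Context (est : est_mode) (by_rewards : 'I_n -> bool).
Hypothesis sigma_gt0 : 0 < sigma.
Hypothesis v_itv : forall i s, 0 <= v i s <= 1.
Local Notation start := (bracket_start R K).

Section one_path.
Variables (Y : 'I_n -> nat -> R) (w : nat -> Omega).
Local Notation width := (conf_width phi sigma sel est w).

Definition deviation q i t s : R :=
  if by_rewards i then
    Num.max 0 (`|clipped_mean phi sel est Y w i t s - v i s| - width q i t s)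
  else 0.

Lemma deviation_ge0 q i t s : 0 <= deviation q i t s.
Proof. by rewrite /deviation; case: ifP => // _; rewrite le_max lexx. Qed.

Lemma conf_width_ge0 q i t s : 0 <= width q i t s.
Proof. by rewrite mulr_ge0 ?sqrtr_ge0// ltW. Qed.

Lemma clip01_dist (x y : R) : 0 <= y <= 1 -> `|clip01 x - y| <= `|x - y|.
Proof.
move=> /andP[y0 y1]; rewrite /clip01.
have [x0|x0] := leP 0 x.
  have [x1|x1] := leP 1 x.
    by rewrite !ger0_norm; lra.
  by [].
have [//|_] := leP 1 (0 : R); first by lra.
by rewrite !ler0_norm; lra.
Qed.

Lemma mean_close q i t s : by_rewards i ->
  `|clipped_mean phi sel est Y w i t s - v i s| <= width q i t s + deviation q i t s.
Proof. by move=> ri; rewrite /deviation ri -lerBlDl le_max lexx orbT. Qed.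

Variable b : 'I_n -> S -> R.
Hypothesis bid_truthful : forall i, ~~ by_rewards i -> b i = v i.

Lemma upper_value_ge q t i s :
  v i s - deviation q i t s <= upper_value phi sigma sel est by_rewards b Y w q t i s.
Proof.
rewrite /upper_value; case: ifPn => [/(mean_close q t s)|/bid_truthful ->].
  by rewrite ler_norml; lra.
by rewrite gerBl deviation_ge0.
Qed.

Lemma upper_value_close q t i s :
  `|upper_value phi sigma sel est by_rewards b Y w q t i s - v i s|
  <= 2 * width q i t s + deviation q i t s.
Proof.
have := conf_width_ge0 q i t s; have := deviation_ge0 q i t s.
rewrite /upper_value; case: ifPn => [/(mean_close q t s)|/bid_truthful ->].
  by rewrite !ler_norml; lra.
by rewrite subrr normr0; lra.
Qed.

Lemma lower_value_close q t i s :
  `|lower_value phi sigma sel est by_rewards b Y w q t i s - v i s|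
  <= 2 * width q i t s + deviation q i t s.
Proof.
have := conf_width_ge0 q i t s; have := deviation_ge0 q i t s.
rewrite /lower_value; case: ifPn => [/(mean_close q t s)|/bid_truthful ->].
  by rewrite !ler_norml; lra.
by rewrite subrr normr0; lra.
Qed.

Lemma conf_widthE q i t s : 0 <= conf_log R S K q t ->
  width q i t s = sigma * Num.sqrt (conf_log R S K q t) /
    Num.sqrt (num_used R phi sel est w i t s)%:R.
Proof. by rewrite /conf_log => l0; rewrite /conf_width sqrtrM// sqrtrV// mulrA. Qed.

End one_path.

End deviation.

Section mean_deviation.
Context (R : realType) (n : nat) (Omega S : finType) (phi : 'I_n -> Omega -> S).
Context (sigma : R) (v : 'I_n -> S -> R).
Context (K : nat) (sel : nat -> 'I_n -> S -> 'I_K).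
Context (est : est_mode) (by_rewards : 'I_n -> bool).
Context (d : measure_display) (Xi : measurableType d) (P : probability Xi R).
Context (nu : 'I_n -> S -> probability (measurableTypeR R) R).
Context (w : nat -> Xi -> Omega) (X : 'I_n -> nat -> {RV P >-> R}).
Context (Y : 'I_n -> nat -> Xi -> R).
Hypothesis sigma_gt0 : 0 < sigma.
Hypothesis v_itv : forall i s, 0 <= v i s <= 1.
Hypothesis bandit : bandit_rewards phi nu w X.
Hypothesis sub_gauss : forall i s, sub_gaussian sigma (nu i s) (v i s).
Hypothesis reward_truthful : forall i t x, by_rewards i -> (0 < t)%N ->
  Y i t x = X i t x.
Local Notation start := (bracket_start R K).
Local Notation count i t s x := (num_used R phi sel est (w^~ x) i t s).
Local Notation dev q i t s x :=
  (deviation phi sigma v sel est by_rewards (fun i t => Y i t x) (w^~ x) q i t s).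

(** The part of [used_round] that does not look at the outcome; it serves as the deterministic
    [flag]. *)
Let eligible i s (l : nat) : bool :=
  selected_round R sel i s l ||
  match est with ETC => false | OPT => ~~ explore_round R K l end.

Local Notation M lam i s t x :=
  (exp_supermartingale phi sigma v w X lam i s (eligible i s) t x).

Let exp_supermartingaleE lam i s t x : M lam i s t x =
  expR (lam * \sum_(1 <= l < t | used_round R phi sel est (w^~ x) i s l)
                (X i l x - v i s)
        - lam ^+ 2 * sigma ^+ 2 / 2 * (count i t s x)%:R).
Proof.
rewrite /exp_supermartingale /num_used natr_sum !mulr_sumr -sumrB expR_sum.
rewrite [RHS]big_mkcond; apply: eq_bigr => l _.
by rewrite /exp_increment /used_round andbC mulr1.
Qed.

Let sum_error i s t x : by_rewards i -> (0 < count i t s x)%N ->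
  (\sum_(1 <= l < t | used_round R phi sel est (w^~ x) i s l) Y i l x)
    / (count i t s x)%:R - v i s =
  (\sum_(1 <= l < t | used_round R phi sel est (w^~ x) i s l) (X i l x - v i s))
    / (count i t s x)%:R.
Proof.
move=> ri N0.
have N_neq0 : (count i t s x)%:R != 0 :> R by rewrite pnatr_eq0 -lt0n.
rewrite sumrB mulrBl; congr (_ - _).
  congr (_ / _); rewrite [LHS]big_nat_cond [RHS]big_nat_cond.
  by apply: eq_bigr => l /andP[/andP[l0 _] _]; exact: reward_truthful.
have -> : \sum_(1 <= l < t | used_round R phi sel est (w^~ x) i s l) v i s =
    (count i t s x)%:R * v i s.
  by rewrite /num_used natr_sum mulr_suml; apply: eq_bigr => l _; rewrite mul1r.
by rewrite mulrAC divff// mul1r.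
Qed.

Lemma mean_le_deviation q t T i s : (0 < q)%N -> (0 < K)%N ->
  (start q + K < t <= T)%N -> (forall x, 0 < count i t s x)%N ->
  mean_le P (fun x => dev q i t s x)
    (4 * sigma * Num.sqrt T%:R / ((t - q * K + 1)%:R ^+ 2 * #|S|%:R)).
Proof.
move=> q0 K0 qt Npos.
have S0 : (0 < #|S|)%N by apply/card_gt0P; exists s.
have a1 := conf_log_ge1 S0 q0 K0 qt.
set a := conf_log R S K q t in a1 *.
pose lam (m : nat) : R := Num.sqrt a / (sigma * Num.sqrt m%:R).
pose G m x := sigma / Num.sqrt m%:R * expR (- (a / 2)) *
  (M (lam m) i s t x + M (- lam m) i s t x).
have G0 m x : 0 <= G m x.
  rewrite !mulr_ge0 ?invr_ge0 ?sqrtr_ge0 ?expR_ge0 ?(ltW sigma_gt0)//.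
  by rewrite addr_ge0// exp_supermartingale_ge0.
have mean_M l : mean_le P (fun x => M l i s t x) 1.
  exists (fun x => M l i s t x); split => //.
  - exact: (measurable_exp_supermartingale sigma v bandit).
  - by move=> x; exact: exp_supermartingale_ge0.
  - exact: (integral_exp_supermartingale bandit sub_gauss).
(* One unit of mean for each sign; with [sum_inv_sqrt_le], which contributes [2 sqrt T], this makes
   the factor 4. *)
have mean_G : mean_le P (fun x => \sum_(1 <= m < T.+1) G m x)
    (\sum_(1 <= m < T.+1) sigma / Num.sqrt m%:R * expR (- (a / 2)) * (1 + 1)).
  apply: mean_le_sum => m _; apply: mean_leZ.
    by rewrite !mulr_ge0 ?invr_ge0 ?sqrtr_ge0 ?expR_ge0 ?(ltW sigma_gt0).
  exact: mean_leD.
apply: mean_le_weaken mean_G _ _ => [x|].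
  rewrite /deviation; case: ifPn => ri; last by rewrite sumr_ge0.
  rewrite ge_max sumr_ge0//=.
  set N := count i t s x.
  have NT : (0 < N < T.+1)%N.
    rewrite Npos/= ltnS /N; case: (t) qt => [|t'] qt; first by lia.
    by apply: (leq_trans (num_used_lt _ _ _ _ _ _ _ _)); lia.
  have GN : G N x <= \sum_(1 <= m < T.+1) G m x.
    rewrite (bigD1_seq N) ?iota_uniq ?mem_index_iota//= lerDl.
    by rewrite sumr_ge0.
  apply: le_trans GN.
  set Z := \sum_(1 <= l < t | used_round R phi sel est (w^~ x) i s l)
    (X i l x - v i s).
  have -> : G N x = sigma / Num.sqrt N%:R * expR (- (a / 2)) *
    (expR (lam N * Z - lam N ^+ 2 * sigma ^+ 2 / 2 * N%:R)
     + expR (- lam N * Z - (- lam N) ^+ 2 * sigma ^+ 2 / 2 * N%:R)).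
    by rewrite /G !exp_supermartingaleE.
  apply: le_trans (deviation_le_exp Z sigma_gt0 a1 (Npos x) erefl).
  rewrite lerB//.
  apply: (le_trans (clip01_dist _ (v_itv i s))).
  rewrite -/N sum_error//.
  by rewrite normrM normfV [X in _ / X]ger0_norm.
have exp_le := expR_conf_log S0 q0 K0 qt; rewrite -/a in exp_le.
have sum_le := sum_inv_sqrt_le R T.
set tau := (t - q * K + 1)%N in exp_le *.
rewrite -mulr_suml -mulr_suml -mulr_sumr.
set I := \sum_(1 <= m < T.+1) _ in sum_le *.
have I0 : 0 <= I by rewrite sumr_ge0// => m _; rewrite invr_ge0 sqrtr_ge0.
have : sigma * I * expR (- (a / 2)) <=
    sigma * (2 * Num.sqrt T%:R) * (tau%:R ^+ 2 * #|S|%:R)^-1.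
  apply: ler_pM => //; rewrite ?expR_ge0 ?mulr_ge0 ?(ltW sigma_gt0)//.
  by apply: ler_wpM2l => //; exact: ltW.
move: (expR _) ((_ * _)^-1) => E F; lra.
Qed.

End mean_deviation.

(** * Regret bounds *)

Lemma bracket_unique (R : realType) (K q q' t : nat) :
  (0 < q)%N -> (0 < q')%N ->
  (bracket_start R K q < t <= bracket_start R K q.+1)%N ->
  (bracket_start R K q' < t <= bracket_start R K q'.+1)%N -> q = q'.
Proof.
move=> q0 q'0 /andP[qt tq] /andP[q't tq'].
have mono a c : (0 < a <= c)%N -> (bracket_start R K a <= bracket_start R K c)%N.
  move=> /andP[a0]; rewrite leq_eqVlt => /predU1P[->//|ac].
  have : (0 < a < c)%N by rewrite a0.
  by move=> /(@bracket_start_mono R K)/(leq_trans (leq_addr _ _)).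
have [lt|lt|//] := ltngtP q q'.
- have /mono : (0 < q.+1 <= q')%N by [].
  by move=> h; have := leq_trans q't tq; rewrite ltnNge h.
- have /mono : (0 < q'.+1 <= q)%N by [].
  by move=> h; have := leq_trans qt tq'; rewrite ltnNge h.
Qed.

Section regret.
Context (R : realType) (sigma : R) (est : est_mode) (n : nat).
Context (Omega S : finType) (phi : 'I_n -> Omega -> S) (v0 : Omega -> R).
Context (v : 'I_n -> S -> R) (ostar : Omega) (Vmax : R) (K : nat).
Context (e : 'I_K -> Omega) (sel : nat -> 'I_n -> S -> 'I_K) (price : price_mode).
Context (d : measure_display) (Xi : measurableType d) (P : probability Xi R).
Context (nu : 'I_n -> S -> probability (measurableTypeR R) R).
Context (X : 'I_n -> nat -> {RV P >-> R}) (by_rewards : 'I_n -> bool).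
Context (b : 'I_n -> S -> R) (Y : 'I_n -> nat -> Xi -> R).
Context (w : nat -> Xi -> Omega) (p : 'I_n -> nat -> Xi -> R) (T : nat).
Hypothesis sigma_gt0 : 0 < sigma.
Hypothesis n_gt0 : (0 < n)%N.
Hypothesis v_itv : forall i s, 0 <= v i s <= 1.
Hypothesis ostar_max : is_unique_argmax (welfare phi v0 v) ostar.
Hypothesis welfare_le : forall o, welfare phi v0 v o <= Vmax.
Hypothesis v0_ge : forall o, - Vmax <= v0 o.
Hypothesis sel_valid : valid_selection phi e sel.
Hypothesis sub_gauss : forall i s, sub_gaussian sigma (nu i s) (v i s).
Hypothesis bandit : bandit_rewards phi nu w X.
Hypothesis truth : truthful X v by_rewards b Y.
Hypothesis learn : forall x : Xi,
  vcg_learn phi v0 sigma e sel est price by_rewards b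
    (fun i t => Y i t x) (fun t => w t x) (fun i t => p i t x).
Hypothesis KT : (2 * K < T)%N.

Local Notation start := (bracket_start R K).
Local Notation width q i t s x := (conf_width phi sigma sel est (w^~ x) q i t s).
Local Notation dev q i t s x :=
  (deviation phi sigma v sel est by_rewards (fun i t => Y i t x) (w^~ x) q i t s).
Local Notation count i t s x := (num_used R phi sel est (w^~ x) i t s).

Let K_gt0 : (0 < K)%N.
Proof.
pose i0 := Ordinal n_gt0.
exact: leq_ltn_trans (leq0n _) (ltn_ord (sel 0 i0 (phi i0 ostar))).
Qed.

Let S_gt0 : (0 < #|S|)%N.
Proof. by apply/card_gt0P; exists (phi (Ordinal n_gt0) ostar). Qed.

Let explored x q (r : 'I_K) : (0 < q)%N -> w (start q + r.+1)%N x = e r.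
Proof. by move=> q0; case: (learn x) => /(_ q r q0)[]. Qed.

Let count_ge q i t s x : (start q + K < t)%N -> (q <= count i t s x)%N.
Proof. exact: (num_used_ge est K_gt0 sel_valid (explored x)). Qed.

Let kappa : R := sigma * Num.sqrt (5 * ln (#|S| * T)%:R).

Let kappa_ge0 : 0 <= kappa.
Proof. by rewrite mulr_ge0 ?sqrtr_ge0// ltW. Qed.

Let width_count q i t s x : (0 < q)%N -> (start q + K < t <= T)%N ->
  width q i t s x <= kappa / Num.sqrt (count i t s x)%:R.
Proof.
move=> q0 qt; have l1 := conf_log_ge1 S_gt0 q0 K_gt0 qt.
rewrite conf_widthE; last exact: le_trans ler01 l1.
rewrite ler_wpM2r ?invr_ge0 ?sqrtr_ge0//.
have l2 := conf_log_le S_gt0 q0 K_gt0 qt.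
apply: ler_wpM2l; first exact: ltW.
by rewrite ler_sqrt//; lra.
Qed.

Let width_le q i t s x : (0 < q)%N -> (start q + K < t <= T)%N ->
  width q i t s x <= kappa / Num.sqrt q%:R.
Proof.
move=> q0 qt; apply: le_trans (width_count i s x q0 qt) _.
apply: ler_wpM2l => //.
have qN : (q <= count i t s x)%N by apply: count_ge; case/andP: qt.
rewrite lef_pV2 ?posrE ?sqrtr_gt0 ?ltr0n ?(leq_trans q0)//.
by rewrite ler_sqrt// ler_nat.
Qed.

Let bid_truthful i : ~~ by_rewards i -> b i = v i.
Proof. by move=> ri; have := truth i; rewrite (negbTE ri). Qed.

Let exploit_round_le q t x : (0 < q)%N ->
  (start q + K < t <= start q.+1)%N -> (t <= T)%N ->
  round_regret_le phi v0 v ostar (w t x) (fun i => p i t x)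
    (4 * n%:R * (\sum_(i < n) width q i t (phi i (w t x)) x)
     + 2 * n%:R ^+ 2 * (kappa / Num.sqrt q%:R)
     + 4 * n%:R * \sum_(i < n) \sum_s dev q i t s x).
Proof.
move=> q0 qt tT.
have qT : (start q + K < t <= T)%N by case/andP: qt => ->.
case: (learn x) => _ /(_ q t q0 qt)[w_max pE].
have close_f i s : `|price_f phi sigma sel est price by_rewards b
    (fun i t => Y i t x) (w^~ x) q t i s - v i s|
    <= 2 * width q i t s x + dev q i t s x.
  by rewrite /price_f; case: (price);
      [exact: lower_value_close | exact: upper_value_close].
have close_g i s : `|price_g phi sigma sel est price by_rewards b
    (fun i t => Y i t x) (w^~ x) q t i s - v i s|
    <= 2 * width q i t s x + dev q i t s x.
  by rewrite /price_g; case: (price);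
      [exact: upper_value_close | exact: lower_value_close].
apply: (exploit_round_regret ostar_max n_gt0 _ _ _ _ _ close_f close_g w_max pE).
- by move=> i s; exact: conf_width_ge0.
- by move=> i s; exact: deviation_ge0.
- by move=> i s; exact: width_le.
- by move=> i s; exact: upper_value_ge.
- move=> i s; have := upper_value_close phi sel est sigma_gt0
    (fun i t => Y i t x) (w^~ x) bid_truthful q t i s.
  by rewrite ler_norml; lra.
Qed.

Let explore_round_le q t x : (0 < q)%N -> (start q < t <= start q + K)%N ->
  round_regret_le phi v0 v ostar (w t x) (fun i => p i t x) (2 * n%:R * Vmax).
Proof.
move=> q0 /andP[qt tq].
have rK : (t - (start q).+1 < K)%N by lia.
case: (learn x) => /(_ q (Ordinal rK) q0) /=.
have -> : (start q + (t - (start q).+1).+1 = t)%N by lia.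
move=> [_ p0] _; apply: (explore_round_regret ostar_max n_gt0) => // i s.
by case/andP: (v_itv i s).
Qed.

Let mean_dev q t : (0 < q)%N -> (start q + K < t <= T)%N ->
  mean_le P (fun x => \sum_(i < n) \sum_s dev q i t s x)
    (4 * n%:R * sigma * Num.sqrt T%:R / (t - q * K + 1)%:R ^+ 2).
Proof.
move=> q0 qt.
have reward_truthful i l x : by_rewards i -> (0 < l)%N -> Y i l x = X i l x.
  by move=> ri; have := truth i; rewrite ri; exact.
have count_gt0 i s x : (0 < count i t s x)%N.
  by apply: (leq_trans q0); apply: count_ge; case/andP: qt.
have := mean_le_sum (index_enum 'I_n) (p := xpredT) (fun i _ =>
  mean_le_sum (index_enum S) (p := xpredT) (fun s _ =>
    mean_le_deviation sigma_gt0 v_itv bandit sub_gauss reward_truthful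
      q0 K_gt0 qt (count_gt0 i s))).
move/mean_le_weaken; apply => //.
have tau0 : (t - q * K + 1)%:R != 0 :> R by rewrite pnatr_eq0 addn1.
have S0 : #|S|%:R != 0 :> R by rewrite pnatr_eq0 -lt0n.
have sumS (a : R) : \sum_(s : S) a = #|S|%:R * a by rewrite sumr_const mulr_natl.
have sumI (a : R) : \sum_(i < n) a = n%:R * a.
  by rewrite sumr_const card_ord mulr_natl.
rewrite sumI sumS.
move: ((t - q * K + 1)%:R : R) tau0 (#|S|%:R : R) S0 => tau tau0 c c0.
by rewrite le_eqVlt; apply/orP; left; apply/eqP; field; rewrite tau0 c0.
Qed.

Let rho : R := regret_rate R K T.

(* The widths at the chosen outcomes are paid for either in each exploit round,
   at rate B1 / sqrt q (for ETC), or by the lump sum W2 (for OPT). *)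
Lemma mean_vcg_regret_le (bracket : nat -> nat) (B1 W2 : R) :
  (forall t, (0 < t)%N -> (0 < bracket t)%N /\
    (start (bracket t) < t <= start (bracket t).+1)%N) ->
  0 <= B1 -> 0 <= W2 ->
  (forall x, \sum_(1 <= t < T.+1 | (start (bracket t) + K < t)%N)
      \sum_(i < n) width (bracket t) i t (phi i (w t x)) x <=
    \sum_(1 <= t < T.+1 | (start (bracket t) + K < t)%N)
      B1 / Num.sqrt (bracket t)%:R + W2) ->
  mean_le P (fun x => vcg_regret phi v0 v ostar (fun t => w t x)
                        (fun i t => p i t x) T)
    ((2 * n%:R * Vmax + 5 / 6 * (4 * n%:R * B1 + 2 * n%:R ^+ 2 * kappa))
       * (3 / 2 * rho + 1)
     + 16 * n%:R ^+ 2 * sigma * Num.sqrt T%:R + 4 * n%:R * W2).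
Proof.
move=> bracketP B10 W20 width_sum.
have V0 : 0 <= Vmax.
  apply: (Vmax_ge0 (phi := phi) (v0 := v0) (v := v) ostar) => // i s.
  by case/andP: (v_itv i s).
pose exploited t := (start (bracket t) + K < t)%N.
pose A := 2 * n%:R * Vmax.
pose B := 4 * n%:R * B1 + 2 * n%:R ^+ 2 * kappa.
(* [16 = 4 * 4]: the coefficient [4 n] of the excess in a round times its mean
   [4 n sigma sqrt T / tau^2]. *)
pose C := 16 * n%:R ^+ 2 * sigma * Num.sqrt (T%:R : R).
have A0 : 0 <= A by rewrite !mulr_ge0.
have B0 : 0 <= B.
  by apply: addr_ge0; apply: mulr_ge0 => //; rewrite mulr_ge0 ?exprn_ge0.
have C0 : 0 <= C.
  by rewrite mulr_ge0 ?sqrtr_ge0// mulr_ge0 ?(ltW sigma_gt0)// mulr_ge0 ?exprn_ge0.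
pose G t x := if exploited t
  then B / Num.sqrt (bracket t)%:R
       + 4 * n%:R * \sum_(i < n) \sum_s dev (bracket t) i t s x else A.
pose F t := if exploited t
  then B / Num.sqrt (bracket t)%:R + C / (t - bracket t * K + 1)%:R ^+ 2 else A.
have mean_G t : (0 < t <= T)%N -> mean_le P (G t) (F t).
  move=> /andP[t0 tT]; have [q0 _] := bracketP t t0.
  rewrite /G /F; case: ifPn => [ext|_]; last exact: mean_le_cst.
  have qt : (start (bracket t) + K < t <= T)%N by apply/andP.
  have n4 : 0 <= 4 * n%:R :> R by rewrite mulr_ge0.
  have BK : 0 <= B / Num.sqrt (bracket t)%:R by rewrite divr_ge0// sqrtr_ge0.
  apply: mean_le_weaken (mean_leD (mean_le_cst P BK)
    (mean_leZ n4 (mean_dev q0 qt))) _ _ => //.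
  rewrite lerD2l mulrA ler_wpM2r ?invr_ge0 ?exprn_ge0// /C.
  by rewrite le_eqVlt; apply/orP; left; apply/eqP; ring.
have mean_sum : mean_le P (fun x => \sum_(1 <= t < T.+1) G t x + 4 * n%:R * W2)
    (\sum_(1 <= t < T.+1) F t + 4 * n%:R * W2).
  apply: mean_leD; last by apply: mean_le_cst; rewrite !mulr_ge0.
  have := @mean_le_sum _ _ _ P nat (index_iota 1 T.+1)
    (fun t => (1 <= t < T.+1)%N) G F mean_G.
  move/mean_le_weaken; apply => [x|]; first by rewrite [leLHS]big_nat.
  by rewrite [leRHS]big_nat.
apply: mean_le_weaken mean_sum _ _ => [x|].
  pose beta t := if exploited t
    then 4 * n%:R * (\sum_(i < n) width (bracket t) i t (phi i (w t x)) x)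
       + 2 * n%:R ^+ 2 * (kappa / Num.sqrt (bracket t)%:R)
       + 4 * n%:R * \sum_(i < n) \sum_s dev (bracket t) i t s x else A.
  apply: (@le_trans _ _ (\sum_(1 <= t < T.+1) beta t)).
    apply: vcg_regret_le => t /andP[t0 tT].
    have [q0 /andP[qt tq]] := bracketP t t0.
    rewrite /beta; case: ifPn => ext.
      by apply: exploit_round_le => //; apply/andP.
    by apply: (explore_round_le x q0); rewrite qt leqNgt.
  (* The widths stay within their budget only after summation over rounds, so [beta] is written as
     [G] plus the widths minus the budget, and the sums are compared as wholes. *)
  have betaE t : beta t = G t x
      + 4 * n%:R * (if exploited t then
          \sum_(i < n) width (bracket t) i t (phi i (w t x)) x else 0)
      - 4 * n%:R * (if exploited t then B1 / Num.sqrt (bracket t)%:R else 0).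
    rewrite /beta /G /B; case: ifP => _; last by rewrite !mulr0 addr0 subr0.
    by rewrite mulrDl; ring.
  under eq_bigr do rewrite betaE.
  rewrite sumrB big_split /= -!mulr_sumr -!big_mkcond /= -addrA lerD2l.
  rewrite lerBlDl -mulrDr ler_wpM2l ?mulr_ge0//.
have T_gt0 : (0 < T)%N := leq_ltn_trans (leq0n _) KT.
pose F' t := if (t <= T)%N then F t else 0.
have explore_le q t : (0 < q)%N -> (start q < t <= start q + K)%N -> F' t <= A.
  move=> q0 /andP[qt tq]; rewrite /F'; case: ifP => // tT.
  have t0 : (0 < t)%N := leq_ltn_trans (leq0n _) qt.
  have [b0 bt] := bracketP t t0.
  have qE : bracket t = q.
    apply: (bracket_unique (R := R) (K := K) b0 q0 bt).
    by rewrite qt bracket_startS// (leq_trans tq)// leq_addr.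
  by rewrite /F /exploited qE ltnNge tq.
have exploit_le q t : (0 < q)%N -> (start q + K < t <= start q.+1)%N ->
    F' t <= B / Num.sqrt q%:R + C / (t - q * K + 1)%:R ^+ 2.
  move=> q0 /andP[qt tq]; rewrite /F'; case: ifP => [tT|_]; last first.
    by rewrite addr_ge0// divr_ge0// ?sqrtr_ge0// exprn_ge0.
  have t0 : (0 < t)%N := leq_ltn_trans (leq0n _) qt.
  have [b0 bt] := bracketP t t0.
  have qE : bracket t = q.
    apply: (bracket_unique (R := R) (K := K) b0 q0 bt).
    by rewrite tq andbT (leq_ltn_trans _ qt)// leq_addr.
  by rewrite /F /exploited qE qt.
have [m [r [rK mT sum_le]]] := sum_rounds K_gt0 A0 B0 C0 explore_le exploit_le T_gt0.
rewrite lerD2r; apply: le_trans (_ : \sum_(1 <= t < T.+1)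
    F' t <= _).
  rewrite [leLHS](_ : _ = \sum_(1 <= t < T.+1) F' t)//.
  by apply: eq_big_nat => t /andP[_]; rewrite /F' ltnS => ->.
apply: (le_trans sum_le); rewrite lerD2r ler_wpM2l//.
  by rewrite addr_ge0// mulr_ge0.
exact: explore_count_le mT.
Qed.

Let nR0 : 0 <= n%:R :> R. Proof. by []. Qed.

Let n1 : 1 <= n%:R :> R. Proof. by rewrite ler1n. Qed.

Let T_gt2 : (2 < T)%N. Proof. by move: K_gt0 KT; lia. Qed.

Let L : R := ln (#|S| * T)%:R.

Let L_ge1 : 1 <= L.
Proof. by apply: ln_ge1; rewrite (leq_trans T_gt2)// leq_pmull. Qed.

Let sqrtL_ge1 : 1 <= Num.sqrt L.
Proof. by rewrite -[leLHS]sqrtr1 ler_sqrt// (le_trans ler01). Qed.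

(** [56 / 25] is a rational number just above [sqrt 5]: its square is 5.0176. *)
Let kappa_le : kappa <= 56 / 25 * (sigma * Num.sqrt L).
Proof.
have -> : 56 / 25 * (sigma * Num.sqrt L) = sigma * (56 / 25 * Num.sqrt L) by ring.
apply: ler_wpM2l; first exact: ltW.
rewrite sqrtrM// ler_wpM2r ?sqrtr_ge0//.
rewrite -[leRHS]ger0_norm// -sqrtr_sqr ler_sqrt//; lra.
Qed.

Let rho_ge0 : 0 <= rho. Proof. exact: regret_rate_ge0. Qed.

Let rho_le_of_cube (a : R) : 0 <= a -> a ^+ 3 <= K%:R * T%:R ^+ 2 -> a <= rho.
Proof.
move=> a0; rewrite -regret_rate_cube -/rho => a3.
by rewrite leNgt; apply/negP => lt; move: a3; rewrite leNgt ltrXn2r.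
Qed.

Let K_ge1 : 1 <= K%:R :> R. Proof. by rewrite ler1n. Qed.

Let T_ge3 : 3 <= T%:R :> R. Proof. by rewrite ler_nat. Qed.

(** [K T^2 >= 9 > 2^3]. It serves to replace [3/2 rho + 1] by [2 rho]. *)
Let rho_ge2 : 2 <= rho.
Proof.
apply: rho_le_of_cube => //.
apply: (@le_trans _ _ (1 * 3 ^+ 2)); first by lra.
by apply: ler_pM => //; apply: lerXn2r; rewrite ?nnegrE.
Qed.

Let sqrtT_le_rho : Num.sqrt T%:R <= rho.
Proof.
apply: rho_le_of_cube; rewrite ?sqrtr_ge0//.
have T1 : 1 <= T%:R :> R by apply: le_trans T_ge3; lra.
rewrite exprSr sqr_sqrtr//; apply: (@le_trans _ _ (T%:R * T%:R)).
  by apply: ler_wpM2l => //; exact: sqrtr_le_self.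
by rewrite -expr2 ler_peMl ?exprn_ge0.
Qed.

Let Vmax_ge0' : 0 <= Vmax.
Proof.
apply: (Vmax_ge0 (phi := phi) (v0 := v0) (v := v) ostar) => // i s.
by case/andP: (v_itv i s).
Qed.

Lemma mean_regret_bound : mean_le P
  (fun x => vcg_regret phi v0 v ostar (fun t => w t x) (fun i t => p i t x) T)
  (regret_bound est sigma n K #|S| Vmax T).
Proof.
(* Round 0 lies in no bracket; guarding the property lets [choice] return a total function. *)
have ex_bracket t : exists q, (0 < t)%N ->
    (0 < q)%N /\ (start q < t <= start q.+1)%N.
  by have [->|/(exists_bracket R K_gt0)[q ?]] := posnP t; [exists 0%N | exists q].
have [bracket bracketP] := choice ex_bracket.
have sigmaL : 0 <= sigma * Num.sqrt L by rewrite mulr_ge0 ?sqrtr_ge0// ltW.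
have rho_sigma := ler_wpM2l sigmaL rho_ge2.
have n2 : 0 <= n%:R ^+ 2 :> R by rewrite exprn_ge0.
have nV : 0 <= n%:R * Vmax by rewrite mulr_ge0.
have nVrho : 0 <= Vmax * rho by rewrite mulr_ge0.
have n2V : 0 <= n%:R ^+ 2 * Vmax by rewrite mulr_ge0.
have nsLrho : 0 <= n%:R * (sigma * Num.sqrt L * rho) by rewrite !mulr_ge0// ltW.
have n2sLrho : 0 <= n%:R ^+ 2 * (sigma * Num.sqrt L * rho) by rewrite mulr_ge0// mulr_ge0.
have kappa_rho : n%:R ^+ 2 * (kappa * (3 / 2 * rho + 1)) <=
    n%:R ^+ 2 * (56 / 25 * (sigma * Num.sqrt L) * (2 * rho)).
  apply: ler_wpM2l => //; apply: ler_pM => //; move: rho_ge2;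
    by move: (rho : R) => r; lra.
have sqrtT_rho : n%:R ^+ 2 * (sigma * Num.sqrt T%:R) <=
    n%:R ^+ 2 * (sigma * Num.sqrt L * rho).
  apply: ler_wpM2l => //; rewrite -mulrA; apply: ler_wpM2l; first exact: ltW.
  by apply: le_trans sqrtT_le_rho _; rewrite ler_peMl.
have qT t : (0 < t <= T)%N -> (start (bracket t) + K < t)%N ->
    (0 < bracket t)%N /\ (start (bracket t) + K < t <= T)%N.
  by move=> /andP[t0 tT] ext; split; [case: (bracketP t t0) | apply/andP].
rewrite /regret_bound -/L -/rho; case estE : est.
- have width_sum x : \sum_(1 <= t < T.+1 | (start (bracket t) + K < t)%N)
      \sum_(i < n) width (bracket t) i t (phi i (w t x)) x <=
    \sum_(1 <= t < T.+1 | (start (bracket t) + K < t)%N)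
      (n%:R * kappa) / Num.sqrt (bracket t)%:R + 0.
    rewrite addr0 big_nat_cond [leRHS]big_nat_cond.
    apply: ler_sum => t /andP[tT /(qT t tT)[q0 qt]].
    apply: le_trans (ler_sum _ (fun i _ => width_le i (phi i (w t x)) x q0 qt)) _.
    by rewrite sumr_const card_ord -[_ *+ n]mulr_natl mulrA.
  have nk : 0 <= n%:R * kappa by rewrite mulr_ge0.
  (* The coefficients of [n^2 sigma sqrt(L) rho] add up to [5/6 * 6 * 56/25 * 2 + 16 = 38.4], below
     the available 50. *)
  apply: mean_le_weaken (mean_vcg_regret_le bracketP nk (lexx 0) width_sum) _ _ => //.
  move: kappa_rho sqrtT_rho nV nVrho n2V nsLrho n2sLrho.
  by move: (rho : R) (kappa : R) (Num.sqrt L) => r k sqrtL; lra.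
- pose W := n%:R * (kappa * (2 * Num.sqrt (#|S|%:R * T%:R))).
  have W0 : 0 <= W.
    by apply: mulr_ge0 => //; apply: mulr_ge0 => //; rewrite mulr_ge0 ?sqrtr_ge0.
  have width_sum x : \sum_(1 <= t < T.+1 | (start (bracket t) + K < t)%N)
      \sum_(i < n) width (bracket t) i t (phi i (w t x)) x <=
    \sum_(1 <= t < T.+1 | (start (bracket t) + K < t)%N)
      0 / Num.sqrt (bracket t)%:R + W.
    rewrite [X in _ <= X + _]big1 ?add0r; last by move=> t _; rewrite mul0r.
    rewrite exchange_big /=.
    apply: (@le_trans _ _ 
      (\sum_(i < n) kappa * (2 * Num.sqrt (#|S|%:R * T%:R)))); last first.
      by rewrite sumr_const card_ord -[_ *+ n]mulr_natl.
    apply: ler_sum => i _.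
    pose exploited t := ((0 < t <= T) && (start (bracket t) + K < t))%N.
    apply: (@le_trans _ _ (\sum_(1 <= t < T.+1 | exploited t)
        kappa * (Num.sqrt (count i t (phi i (w t x)) x)%:R)^-1)).
      rewrite big_nat_cond [leRHS]big_nat_cond.
      rewrite [leRHS](eq_bigl (fun t => (0 < t < T.+1)%N &&
        (start (bracket t) + K < t)%N)).
        apply: ler_sum => t /andP[tT /(qT t tT)[q0 qt]].
        exact: width_count.
      by move=> t; rewrite /exploited ltnS andbA andbb.
    rewrite -mulr_sumr ler_wpM2l//.
    apply: (sum_inv_sqrt_num_used_le K_gt0) => t t0 /andP[tT ext].
    have [q0 qt] := qT t tT ext.
    have [_ /andP[_ tq]] := bracketP t t0.
    rewrite (leq_trans q0) ?andbT; last by apply: count_ge; case/andP: qt.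
    (* For OPT an exploit round is itself used, so it raises the very counter whose inverse root it
       pays. *)
    rewrite /used_round eqxx estE (exploit_roundN_explore K_gt0 q0)//.
      by rewrite orbT.
    by apply/andP.
  apply: mean_le_weaken (mean_vcg_regret_le bracketP (lexx 0) W0 width_sum) _ _ => //.
  set Q := Num.sqrt (#|S|%:R * T%:R) in W W0 width_sum *.
  have QE : Num.sqrt (#|S|%:R * T%:R * L) = Q * Num.sqrt L.
    by rewrite sqrtrM// mulr_ge0.
  have Q0 : 0 <= Q := sqrtr_ge0 _.
  have kappa_Q : n%:R ^+ 2 * (kappa * Q) <=
      n%:R ^+ 2 * (56 / 25 * (sigma * Num.sqrt L) * Q).
    by apply: ler_wpM2l => //; apply: ler_wpM2r.
  (* The term [16 n^2 sigma sqrt T] fits into neither leading term alone, as [8 * 56/25 + 16 > 27]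
     and [10/3 * 56/25 + 16 > 20]. It is split between the two by this bound and [sqrtT_rho]. *)
  have sqrtT_Q : n%:R ^+ 2 * (sigma * Num.sqrt T%:R) <=
      n%:R ^+ 2 * (sigma * Num.sqrt L * Q).
    apply: ler_wpM2l => //; rewrite -mulrA; apply: ler_wpM2l; first exact: ltW.
    apply: (@le_trans _ _ Q); last by rewrite ler_peMl.
    by rewrite ler_sqrt ?mulr_ge0// ler_peMl// ler1n.
  have nsLQ : 0 <= n%:R * (sigma * Num.sqrt L * Q) by rewrite !mulr_ge0// ltW.
  rewrite QE /W.
  move: kappa_rho sqrtT_rho nV nVrho n2V nsLrho n2sLrho kappa_Q sqrtT_Q nsLQ.
  by move: (rho : R) (kappa : R) (Num.sqrt L) (Q : R) => r k sqrtL Q'; lra.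
Qed.

End regret.

Theorem theorem4 (R : realType) (sigma : R) (hsigma : 0 < sigma)
    (est : est_mode) :
  (forall (n : nat) (Omega S : finType) (phi : 'I_n -> Omega -> S)
      (v0 : Omega -> R) (v : 'I_n -> S -> R) (ostar : Omega) (Vmax : R)
      (K : nat) (e : 'I_K -> Omega) (sel : nat -> 'I_n -> S -> 'I_K)
      (price : price_mode)
      (d : measure_display) (Xi : measurableType d) (P : probability Xi R)
      (nu : 'I_n -> S -> probability (measurableTypeR R) R)
      (X : 'I_n -> nat -> {RV P >-> R})
      (by_rewards : 'I_n -> bool) (b : 'I_n -> S -> R)
      (Y : 'I_n -> nat -> Xi -> R)
      (w : nat -> Xi -> Omega) (p : 'I_n -> nat -> Xi -> R) (T : nat),
    (0 < n)%N ->
    (forall i s, 0 <= v i s <= 1) ->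
    is_unique_argmax (welfare phi v0 v) ostar ->
    (forall o, welfare phi v0 v o <= Vmax) ->
    (forall o, - Vmax <= v0 o) ->
    is_min_cover_length phi K ->
    covers phi e ->
    valid_selection phi e sel ->
    (forall i s, has_mean (nu i s) (v i s)) ->
    (forall i s, sub_gaussian sigma (nu i s) (v i s)) ->
    bandit_rewards phi nu w X ->
    truthful X v by_rewards b Y ->
    (forall x : Xi,
       vcg_learn phi v0 sigma e sel est price by_rewards b
         (fun i t => Y i t x) (fun t => w t x) (fun i t => p i t x)) ->
    (2 * K < T)%N ->
    ('E_P[fun x => vcg_regret phi v0 v ostar
                     (fun t => w t x) (fun i t => p i t x) T]
       <= (regret_bound est sigma n K #|S| Vmax T)%:E)%E) /\
  (forall c : R, exists (C : R) (a : nat),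
    forall (n K card_S : nat) (Vmax : R),
      (0 < n)%N -> (0 < K)%N -> (0 < card_S)%N -> `|Vmax| <= c * n%:R ->
      \forall T \near \oo,
        `|regret_bound est sigma n K card_S Vmax T|
          <= C * ln ((card_S * T)%:R : R) ^+ a * (n%:R ^+ 2 * regret_rate R K T)).

Proof.
split; last exact: regret_bound_asymptotics.
move=> n Omega S phi v0 v ostar Vmax K e sel price d Xi P nu X by_rewards b Y w p T.
move=> n_gt0 v_itv ostar_max welfare_le v0_ge _ _ sel_valid _ sub_gauss bandit truth.
move=> learn KT; apply: expectation_mean_le.
exact: (mean_regret_bound hsigma n_gt0 v_itv ostar_max welfare_le v0_ge sel_valid
  sub_gauss bandit truth learn KT).
Qed.
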